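(* The space $\overline{B_\infty}=G(X,H(Z^+,Z^+))$ is topologically complete, i.e. its topology is induced by some complete metric.
   Context: Spaces of continuous functions carry the compact-open topology, subsets the subspace topology, and quotients the quotient topology. Let $Z^+=\{(n,0)\in\mathbb R^2 : n\in\{1,2,3,\dots\}\}$ (a discrete set). Let $X=I(Z^+,\mathbb R^2)$ be the space of all one-to-one (automatically continuous) functions $Z^+\to\mathbb R^2$; its elements need not be embeddings. Let $H(Z^+,Z^+)$ be the group of homeomorphisms (i.e. bijections) of $Z^+$ onto itself, regarded as a subspace of $X$. Let $[0,\infty]$ be the one-point compactification of $[0,\infty)$ (homeomorphic to $[0,1]$) and let $$K=\{f\in C([0,\infty],X) : f(0)=\mathrm{id}_{Z^+},\ f(\infty)\in H(Z^+,Z^+)\}.$$ $G(X,H(Z^+,Z^+))$ denotes the set of path components of $K$, with the quotient topology from $K$. This space is denoted $\overline{B_\infty}$. *)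

(* Defs.v *)
From HB Require Import structures.
From mathcomp Require Import all_boot all_order all_algebra generic_quotient.
From mathcomp Require Import all_classical all_reals.
From mathcomp Require Import topology normedtype.

Set Implicit Arguments.
Unset Strict Implicit.
Unset Printing Implicit Defensive.

Import Order.TTheory GRing.Theory Num.Theory.
Import numFieldNormedType.Exports.

Local Open Scope classical_set_scope.
Local Open Scope ring_scope.
Local Open Scope quotient_scope.

(* A subset [A] used as a space is the type [set_type A], whose
   topology is the subspace topology.  Function spaces are such subspaces of
   [{compact-open, S -> T}], which contains all functions from [S] to [T], so
   continuity is imposed where it is not automatic. *)

Section TopologicalNotions.
Context {S T : topologicalType}.

Definition homeomorphism (h : S -> T) : Prop :=
  continuous h /\
  exists g : T -> S, [/\ continuous g, cancel h g & cancel g h].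

End TopologicalNotions.

Section CompleteMetrizability.
Context {R : realType} {T : topologicalType}.
Implicit Type d : T -> T -> R.

Definition is_metric d : Prop :=
  [/\ forall x y, 0 <= d x y,
      forall x y, d x y = 0 <-> x = y,
      forall x y, d x y = d y x &
      forall x y z, d x z <= d x y + d y z].

Definition induces_topology d : Prop :=
  forall U : set T, open U <->
    (forall x, U x -> exists2 e : R, 0 < e & [set y | d x y < e] `<=` U).

Definition complete_metric d : Prop :=
  forall u : nat -> T,
    (forall e : R, 0 < e -> exists N : nat, forall m n : nat,
      (N <= m)%N -> (N <= n)%N -> d (u m) (u n) < e) ->
    exists l : T, forall e : R, 0 < e -> exists N : nat, forall n : nat,
      (N <= n)%N -> d (u n) l < e.

End CompleteMetrizability.

Definition topologically_complete (R : realType) (T : topologicalType) : Prop :=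
  exists d : T -> T -> R,
    [/\ is_metric d, induces_topology d & complete_metric d].

Section PathComponents.
Context (R : realType) (T : topologicalType).

Definition path_joined (x y : T) : Prop :=
  exists g : R -> T,
    [/\ {within `[0, 1], continuous g}, g 0 = x & g 1 = y].

Lemma path_joined_refl x : path_joined x x.
Proof.
by exists (cst x); split=> //; apply: continuous_subspaceT; exact: cst_continuous.
Qed.

Let within_continuous_reparam (A B : set R) (phi : R -> R) (g : R -> T) :
  continuous phi -> (forall t, A t -> B (phi t)) ->
  {within B, continuous g} -> {within A, continuous (g \o phi)}.
Proof.
move=> cphi AB /subspace_continuousP cg; apply/subspace_continuousP => t At.
move=> U Ugt; have gU := cg (phi t) (AB _ At) U Ugt.
have : nbhs t (phi @^-1` [set s | B s -> U (g s)]) by exact: cphi gU.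
by apply: (@filterS _ (nbhs t)) => s /= Us As; exact/Us/AB.
Qed.

Lemma path_joined_sym x y : path_joined x y -> path_joined y x.
Proof.
move=> [g [cg g0 g1]]; exists (g \o (fun t => 1 - t)); split=> /=.
- apply: within_continuous_reparam cg => [t|t /=].
    by apply: cvgB; [exact: cvg_cst|exact: cvg_id].
  by rewrite !in_itv/= subr_ge0 lerBlDr lerDl andbC.
- by rewrite subr0.
- by rewrite subrr.
Qed.

Lemma path_joined_trans y x z :
  path_joined x y -> path_joined y z -> path_joined x z.
Proof.
move=> [g [cg g0 g1]] [h [ch h0 h1]].
pose p t := t *+ 2 : R; pose q t := t *+ 2 - 1 : R.
have cp : continuous p by move=> t; apply: cvgMn; exact: cvg_id.
have cq : continuous q by move=> t; apply: cvgB; [exact: cp|exact: cvg_cst].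
have h21 : 2^-1 *+ 2 = 1 :> R by rewrite -[LHS]mulr_natr mulVf // pnatr_eq0.
have p0 : p 0 = 0 by rewrite /p mul0rn.
have ph : p 2^-1 = 1 by exact: h21.
have qh : q 2^-1 = 0 by rewrite /q h21 subrr.
have q1 : q 1 = 1 by rewrite /q mulr2n addrK.
have pE t : (p t <= 1) = (t <= 2^-1) by rewrite /p -[X in _ <= X]h21 lerMn2r.
have qE t : (0 <= q t) = (2^-1 <= t) by rewrite /q subr_ge0 -[X in X <= _]h21 lerMn2r.
exists (fun t => if t <= 2^-1 then g (p t) else h (q t)); split; last 2 first.
- by rewrite invr_ge0 ler0n p0.
- by rewrite leNgt invf_lt1 ?ltr1n ?ltr0n//= q1.
have -> : `[0, 1]%classic = `[0, 2^-1]%classic `|` `[2^-1, 1]%classic :> set R.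
  apply/seteqP; split=> t /=; rewrite !in_itv/=.
    move=> /andP[-> ->]; rewrite andbT /=.
    by case: (leP t 2^-1) => [?|/ltW ?]; [left|right].
  move=> [|] /andP[a b]; apply/andP; split=> //.
    by apply: le_trans b _; rewrite invf_le1 ?ler1n ?ltr0n.
  by apply: le_trans a; rewrite invr_ge0 ler0n.
apply: withinU_continuous; [exact: interval_closed|exact: interval_closed| |].
- apply: (@subspace_eq_continuous _ _ _ (g \o p)).
    move=> t; rewrite inE /= in_itv/= => /andP[_ t2].
    by rewrite /from_subspace /= t2.
  apply: within_continuous_reparam cg => // t /=; rewrite !in_itv/= pE.
  by move=> /andP[t0 ->]; rewrite andbT /p mulrn_wge0.
- apply: (@subspace_eq_continuous _ _ _ (h \o q)).
    move=> t; rewrite inE /= in_itv/= => /andP[t1 _].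
    rewrite /from_subspace /=; case: (leP t 2^-1) => // t2.
    by have -> : t = 2^-1 by [apply/eqP; rewrite eq_le t1 t2]; rewrite qh ph g1.
  apply: within_continuous_reparam ch => // t /=; rewrite !in_itv/= qE.
  by move=> /andP[-> t1] /=; rewrite /q lerBlDr -mulr2n lerMn2r.
Qed.

Definition path_joinedb : rel T := fun x y => `[< path_joined x y >].

Lemma path_joinedb_equiv : equiv_class_of path_joinedb.
Proof.
split=> [x|x y|y x z].
- exact/asboolP/path_joined_refl.
- by apply/asboolP/asboolP; exact: path_joined_sym.
- by move=> /asboolP xy /asboolP yz; apply/asboolP; exact: path_joined_trans yz.
Qed.

Canonical path_joined_equivRel := EquivRelPack path_joinedb_equiv.

Definition path_components : topologicalType :=
  quotient_topology {eq_quot path_joined_equivRel}.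

End PathComponents.

Section ExtendedHalfLine.
Context {R : realType}.

Definition half_line : set R := `[0, +oo[.

Definition extended_half_line : topologicalType :=
  one_point_compactification half_line.

Lemma half_line0 : 0 \in half_line.
Proof. by apply/mem_set; rewrite /half_line /= in_itv/= lexx. Qed.

Definition ehl0 : extended_half_line := Some (exist _ 0 half_line0).

Definition ehloo : extended_half_line := None.

End ExtendedHalfLine.
Arguments half_line : clear implicits.
Arguments extended_half_line : clear implicits.

(* G(X, A) for paths that start at a base point [x0] and end in [A]. *)
Section GSpace.
Context (R : realType) (X : topologicalType) (x0 : X) (A : set X).

Definition paths_into : set {compact-open, extended_half_line R -> X} :=
  [set f | [/\ continuous (f : extended_half_line R -> X),
               f ehl0 = x0 & A (f ehloo)]].

Definition Gspace : topologicalType := path_components R (set_type paths_into).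

End GSpace.

Section InfiniteBraids.
Context (R : realType).

Definition Zplus : set (R * R) :=
  [set p | exists n : nat, (0 < n)%N /\ p = (n%:R, 0)].

(* I(Z^+, R^2); its elements are continuous because Z^+ is discrete. *)
Definition injections : set {compact-open, Zplus -> (R * R)%type} :=
  [set f | injective (f : Zplus -> (R * R)%type)].

Definition Xspace : topologicalType := set_type injections.

Lemma id_Zplus_subproof :
  (set_val : {compact-open, Zplus -> (R * R)%type}) \in injections.
Proof. by apply/mem_set; exact: val_inj. Qed.

Definition id_Zplus : Xspace :=
  (SigSub id_Zplus_subproof : set_type injections).

(* H(Z^+, Z^+) inside X: homeomorphisms of Z^+ followed by the inclusion. *)
Definition H_Zplus : set Xspace :=
  [set f | exists2 h : Zplus -> Zplus,
     homeomorphism h & forall z, set_val f z = set_val (h z)].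

Definition Boo_bar : topologicalType := Gspace R id_Zplus H_Zplus.

End InfiniteBraids.

(* Main.v *)
(* An element of [K] is a braid with infinitely many strands from the identity
   to a permutation.  Call two braids equivalent up to [n] when their first [n]
   strands are homotopic; dragging the plane along with the strands shows that
   then one of them can be deformed until its first [n] strands coincide with
   those of the other.  Hence every class up to [n] is open in [K], and the
   classes up to [n], for all [n], give a basis of the quotient topology.
   Asking in addition that the same strands end at the first [n] points defines
   a chain of equivalence relations, hence an ultrametric, and a Cauchy sequence
   converges because representatives can be chosen whose strands stabilize.

   The distance separates points because braids that are equivalent up to every
   [n] are homotopic.  The homotopy is built strand by strand: a homotopy of [n]
   strands has to be extended to one more strand with prescribed boundary values,
   knowing that some other homotopy [h'] of [n + 1] strands has this boundary.
   Run [h'] from the boundary of the square to its centre, move the new strand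
   far away while the others rest, run [h'] backwards and then the given homotopy
   with the new strand waiting at infinity.  This is a deformation, rel boundary,
   of the given homotopy, so the new strand can be carried over to it. *)
Require Import Defs.
From mathcomp Require Import all_boot all_order all_algebra.
From mathcomp Require Import all_classical all_reals.
From mathcomp Require Import topology normedtype.
From mathcomp Require Import generic_quotient ring lra.

Set Implicit Arguments.
Unset Strict Implicit.
Unset Printing Implicit Defensive.

Import Order.TTheory GRing.Theory Num.Theory.
Import numFieldNormedType.Exports.

Local Open Scope classical_set_scope.
Local Open Scope ring_scope.

(** * Complete ultrametrics from chains of equivalence relations *)

Section EquivalenceChain.
Context (R : realType) (T : topologicalType) (A : nat -> T -> T -> Prop).
Hypothesis Arefl : forall n x, A n x x.
Hypothesis Asym : forall n x y, A n x y -> A n y x.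
Hypothesis Atrans : forall n x y z, A n x y -> A n y z -> A n x z.
Hypothesis Adecr : forall n x y, A n.+1 x y -> A n x y.
Hypothesis Asep : forall x y, (forall n, A n x y) -> x = y.
Hypothesis Aopen : forall U : set T,
  open U <-> forall x, U x -> exists n, A n x `<=` U.
Hypothesis Acomplete : forall u : nat -> T, (forall n, A n (u n) (u n.+1)) ->
  exists l, forall n, A n (u n) l.

Let Amono m n x y : (m <= n)%N -> A n x y -> A m x y.
Proof.
elim: n => [|n IH]; first by rewrite leqn0 => /eqP ->.
by rewrite leq_eqVlt ltnS => /orP[/eqP ->//|/IH h /Adecr].
Qed.

(** With [m] the least index at which [A m x y] fails, [d] is [m.+1%:R^-1], and [0] if there is
    none. The shift by one makes the ball of radius [n.+1%:R^-1] exactly the class under [A n]. *)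
Let first_difference x y : exists d : R,
  [/\ 0 <= d, forall n, d < n.+1%:R^-1 <-> A n x y
    & d = 0 \/ exists m, d = m.+1%:R^-1].
Proof.
have [h|h] := pselect (exists n, `[< ~ A n x y >]); last first.
  exists 0; split=> //; last by left.
  move=> n; split=> [_|_]; last by rewrite invr_gt0 ltr0n.
  by apply: contrapT => nA; apply: h; exists n; exact/asboolP.
case: (ex_minnP h) => m /asboolP nAm mmin.
exists m.+1%:R^-1; split; [by rewrite invr_ge0 ler0n| |by right; exists m].
move=> n; rewrite ltf_pV2 ?posrE ?ltr0n// ltr_nat ltnS; split => [nm|An].
  by apply: contrapT => nA; move: (mmin n); rewrite leqNgt nm => /(_ (asboolT nA)).
by rewrite ltnNge; apply/negP => mn; exact/nAm/(Amono mn).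
Qed.

Lemma topologically_complete_equivalence_chain : topologically_complete R T.
Proof.
pose d x y := projT1 (cid (first_difference x y)).
have d0 x y : 0 <= d x y by rewrite /d; case: cid => ? [].
have dA x y n : d x y < n.+1%:R^-1 <-> A n x y by rewrite /d; case: cid => ? [].
have dv x y : d x y = 0 \/ exists m, d x y = m.+1%:R^-1.
  by rewrite /d; case: cid => ? [].
have small (e : R) : 0 < e -> exists n : nat, n.+1%:R^-1 < e.
  move=> e0; exists (Num.bound e^-1).
  rewrite -[ltRHS]invrK ltf_pV2 ?posrE ?invr_gt0 ?ltr0n//.
  apply: lt_le_trans (archi_boundP _) _; first by rewrite invr_ge0 ltW.
  by rewrite ler_nat.
have ultra x y z : d x z <= Num.max (d x y) (d y z).
  have [->|[m xzE]] := dv x z; first by rewrite le_max d0.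
  rewrite leNgt; apply/negP; rewrite gt_max xzE => /andP[/dA h1 /dA h2].
  by have := dA x z m; rewrite xzE ltxx => -[_ /(_ (Atrans h1 h2))].
have dle x y : d y x <= d x y.
  have [->|[m yxE]] := dv y x; first exact: d0.
  rewrite leNgt; apply/negP; rewrite yxE => /dA /Asym /dA.
  by rewrite yxE ltxx.
exists d; split.
- split=> //.
  + move=> x y; split=> [xy|->].
      by apply: Asep => n; apply/dA; rewrite xy invr_gt0 ltr0n.
    have [//|[m yE]] := dv y y.
    by have /dA := Arefl m y; rewrite yE ltxx.
  + by move=> x y; apply/eqP; rewrite eq_le !dle.
  + move=> x y z; apply: le_trans (ultra x y z) _.
    by rewrite ge_max lerDl d0 lerDr d0.
- move=> U; rewrite Aopen; split=> h x Ux.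
  + have [n nU] := h x Ux; exists n.+1%:R^-1; first by rewrite invr_gt0 ltr0n.
    by move=> y /dA; exact: nU.
  + have [e e0 eU] := h x Ux; have [n ne] := small e e0.
    by exists n => y /dA yn; apply: eU; exact: lt_trans ne.
- move=> u uC.
  have /choice[N NP] n : exists N, forall p q, (N <= p)%N -> (N <= q)%N ->
      A n (u p) (u q).
    have [|N NP] := uC n.+1%:R^-1; first by rewrite invr_gt0 ltr0n.
    by exists N => p q Np Nq; apply/dA/NP.
  (* [Acomplete] only takes sequences whose [n]-th and next terms are related by [A n]; the running
     maximum makes the indices nondecreasing, so [u \o M] is such a sequence. *)
  pose M n := \max_(i < n.+1) N i.
  have NM n : (N n <= M n)%N by exact: (leq_bigmax (Ordinal (ltnSn n))).
  have MS n : (M n <= M n.+1)%N by rewrite /M [leqRHS]big_ord_recr /= leq_maxl.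
  have [|l lP] := @Acomplete (u \o M).
    by move=> n; apply: NP => //; apply: leq_trans (NM n) (MS n).
  exists l => e /small[n ne]; exists (M n) => m Mm.
  apply: lt_trans ne; apply/dA; apply: Atrans (lP n) => /=.
  by apply: NP => //; exact: leq_trans Mm.
Qed.

End EquivalenceChain.

(** The truth set of [P] and its complement are both open, and a segment is connected. This carries
    along a whole path a property that can only be moved over short parameter intervals. *)
Lemma locally_constant_prop (R : realType) (P : R -> Prop) (a b : R) :
  (forall u, \forall v \near u, P u <-> P v) -> P a -> P b.
Proof.
move=> loc Pa.
suff E : `[Num.min a b, Num.max a b]%classic `&` [set u | P u]
    = `[Num.min a b, Num.max a b]%classic.
  suff : (`[Num.min a b, Num.max a b]%classic `&` [set u | P u]) b by case.
  by rewrite E /= in_itv/= ge_min le_max lexx !orbT.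
apply: (@segment_connected R (Num.min a b) (Num.max a b)).
- by exists a; split=> //; rewrite /= in_itv/= ge_min le_max lexx.
- exists [set u | P u] => //.
  rewrite openE => u /= Pu; rewrite /interior.
  by apply: filterS (loc u) => v [h _]; exact: h.
- exists [set u | P u] => //.
  rewrite -[X in closed X]setCK; apply: open_closedC.
  rewrite openE => u /= nPu; rewrite /interior.
  by apply: filterS (loc u) => v [_ h] /h.
Qed.

(** * Carrying a strand along a homotopy of configurations *)

Lemma cvg_maxr (R : realType) (T : Type) (F : set_system T) {FF : Filter F}
    (f g : T -> R) (l m : R) :
  f @ F --> l -> g @ F --> m -> (fun t => Num.max (f t) (g t)) @ F --> Num.max l m.
Proof.
move=> fl gm; rewrite maxr_absE.
rewrite (_ : (fun t => _) = (fun t => (f t + g t + `|f t - g t|) / 2)); last first.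
  by apply/funext => t; rewrite maxr_absE.
apply: cvgMr_tmp; apply: cvgD; first exact: cvgD.
by apply: cvg_norm; exact: cvgB.
Qed.

Section Push.
Context {R : realType} {V : normedModType R}.
Implicit Types (a b : nat -> V) (x y : V) (r : R).

Definition bump r x : R := Num.max 0 (1 - `|x| / r).

(* Drags each centre [a i] to [b i]; when the [b i - a i] are small this is a
   Lipschitz perturbation of the identity, hence injective. *)
Definition push n r a b x : V := x + \sum_(i < n) bump r (x - a i) *: (b i - a i).

Lemma bump0 r : bump r 0 = 1.
Proof. by rewrite /bump normr0 mul0r subr0 max_r. Qed.

Lemma bump_far r x : 0 < r -> r <= `|x| -> bump r x = 0.
Proof.
by move=> r0 rx; rewrite /bump max_l// subr_le0 ler_pdivlMr// mul1r.
Qed.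

Lemma bump_lipschitz r x y : 0 < r -> `|bump r x - bump r y| <= `|x - y| / r.
Proof.
move=> r0; have lip p q : `|Num.max 0 p - Num.max 0 q| <= `|p - q| :> R.
  by case: (leP 0 p) => hp; case: (leP 0 q) => hq;
    rewrite ler_norml; apply/andP; split; case: (ler0P (p - q)) => ?; lra.
apply: le_trans (lip _ _) _.
rewrite (_ : 1 - _ - _ = (`|y| - `|x|) / r); last by rewrite mulrBl; ring.
rewrite normrM (gtr0_norm (x := r^-1)) ?invr_gt0// ler_pM2r ?invr_gt0//.
by rewrite (distrC x) ler_dist_dist.
Qed.

Lemma push_center n r a b j : 0 < r -> (j < n)%N ->
  (forall i, (i < n)%N -> i != j -> r <= `|a i - a j|) ->
  push n r a b (a j) = b j.
Proof.
move=> r0 jn sep; rewrite /push (bigD1 (Ordinal jn))//= subrr bump0 scale1r.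
rewrite big1 ?addr0; first by rewrite addrC subrK.
move=> i /= ij.
by rewrite bump_far ?scale0r// distrC sep.
Qed.

Lemma push_id n r a b x : (forall i, (i < n)%N -> b i = a i) ->
  push n r a b x = x.
Proof.
by move=> ab; rewrite /push big1 ?addr0// => i _; rewrite ab// subrr scaler0.
Qed.

(** The displacement has Lipschitz constant at most [n%:R * e / r], which is below 1, so distinct
    points cannot be moved to the same point. *)
Lemma push_inj n r e a b x y : 0 < r -> n%:R * e < r ->
  (forall i, (i < n)%N -> `|b i - a i| <= e) ->
  push n r a b x = push n r a b y -> x = y.
Proof.
move=> r0 er close /eqP; rewrite /push -subr_eq0 opprD addrACA -sumrB.
rewrite addr_eq0 => /eqP xy; apply/eqP; rewrite -subr_eq0 -normr_le0 leNgt.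
apply/negP => d0; suff : `|x - y| <= `|x - y| / r * (n%:R * e).
  rewrite leNgt -mulrA gtr_pMr// mulrC ltr_pdivrMr// mul1r er.
  by [].
rewrite {1}xy normrN; apply: le_trans (ler_norm_sum _ _ _) _.
rewrite (le_trans (y := \sum_(i < n) `|x - y| / r * e))//; last first.
  by rewrite sumr_const card_ord -mulrnAr -mulr_natl.
apply: ler_sum => i _; rewrite -scalerBl normrZ ler_pM//; last exact: close.
apply: le_trans (bump_lipschitz _ _ _) _ => //.
by rewrite opprB addrA subrK.
Qed.

Lemma cvg_push (T : Type) (F : set_system T) {FF : Filter F} n r
    (a b : T -> nat -> V) (x : T -> V) a0 b0 x0 :
  (forall i, (i < n)%N -> a^~ i @ F --> a0 i) ->
  (forall i, (i < n)%N -> b^~ i @ F --> b0 i) -> x @ F --> x0 ->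
  (fun t => push n r (a t) (b t) (x t)) @ F --> push n r a0 b0 x0.
Proof.
move=> ca cb cx; apply: cvgD => //.
apply: (cvg_big (@add_continuous V)) => i _.
apply: cvgZ; last by apply: cvgB; [exact: cb|exact: ca].
apply: cvg_maxr; first exact: cvg_cst.
apply: cvgB; first exact: cvg_cst.
by apply: cvgMr_tmp; apply: cvg_norm; apply: cvgB => //; exact: ca.
Qed.

End Push.

Section Configurations.
Context {R : realType} {V : normedModType R}.

Definition distinct n (a : nat -> V) : Prop :=
  forall i k, (i < n)%N -> (k < n)%N -> i != k -> a i != a k.

(** Near each point, half the distance of two strands is a lower bound; compactness makes the bound
    uniform for all small [r], and there are finitely many pairs. *)
Lemma uniform_separation (Z : topologicalType) (C : set Z) n (a : nat -> Z -> V) :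
  compact C -> (forall i, (i < n)%N -> continuous (a i)) ->
  (forall z, C z -> distinct n (a^~ z)) ->
  exists2 r : R, 0 < r & forall z i k, C z -> (i < n)%N -> (k < n)%N -> i != k ->
    r <= `|a i z - a k z|.
Proof.
move=> cC ca da.
have : \forall r \near 0^'+, forall i k : 'I_n, forall z, C z -> i != k ->
    r <= `|a i z - a k z|.
  apply: filter_forall => i; apply: filter_forall => k.
  apply: (iffLR (compact_near_coveringP C) cC) => // z Cz.
  have [->|ik] := eqVneq i k; first by exists (setT, setT) => //=; split; exact: filterT.
  have d0 : 0 < `|a i z - a k z|.
    by rewrite normr_gt0 subr_eq0; apply: (da z Cz) => //.
  have cn : (fun z' => `|a i z' - a k z'|) @ z --> `|a i z - a k z|.
    by apply: cvg_norm; apply: cvgB; exact: ca.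
  exists ([set z' | `|a i z - a k z| / 2 < `|a i z' - a k z'|],
          [set r | r < `|a i z - a k z| / 2]) => /=.
    split; first by apply: (cvgr_gt _ cn); lra.
    by apply: nbhs_right_lt; lra.
  by move=> [z' r] /= [h1 h2] _; apply: ltW; exact: lt_trans h1.
move=> H; have [r [rP r0]] := filter_ex (filterI H (nbhs_right_gt 0)).
exists r => // z i k Cz i_n kn ik.
exact: (rP (Ordinal i_n) (Ordinal kn) z Cz).
Qed.

Lemma compact_uniform_near (W Z : topologicalType) (C : set Z)
    (g : W -> Z -> V) (w0 : W) (e : R) :
  compact C -> 0 < e ->
  (forall z, C z -> {for (w0, z), continuous (fun p => g p.1 p.2)}) ->
  \forall w \near w0, forall z, C z -> `|g w z - g w0 z| < e.
Proof.
move=> cC e0 cg; apply: (iffLR (compact_near_coveringP C) cC) => // z Cz.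
have e20 : 0 < e / 2 by lra.
have /cvgrPdist_lt/(_ _ e20) [[A B] /= [nA nB] AB] := cg z Cz.
exists (B, A) => //= -[z' w] /= [Bz' Aw].
rewrite -(subrK (g w0 z) (g w z')) -addrA (le_lt_trans (ler_normD _ _))//.
have h1 := AB (w, z') (conj Aw Bz').
have h2 := AB (w0, z') (conj (nbhs_singleton nA) Bz').
by move: h1 h2 => /=; rewrite (distrC _ (g w z')); lra.
Qed.

(** The strand [x] is dragged by the same [push] as the centres, and injectivity keeps it off them.
    Where nothing moves, [push] is the identity; this alternative allows one [r] to serve on a
    noncompact [Z]. *)
Lemma avoid_push (Z : topologicalType) n r e (a b : nat -> Z -> V) (x : Z -> V) :
  0 < r -> n%:R * e < r ->
  (forall i, (i < n)%N -> continuous (a i)) ->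
  (forall i, (i < n)%N -> continuous (b i)) -> continuous x ->
  (forall z, (forall i, (i < n)%N -> b i z = a i z) \/
    (forall i k, (i < n)%N -> (k < n)%N -> i != k -> r <= `|a i z - a k z|) /\
    (forall i, (i < n)%N -> `|b i z - a i z| <= e)) ->
  (forall z i, (i < n)%N -> x z != a i z) ->
  exists x', [/\ continuous x', forall z i, (i < n)%N -> x' z != b i z &
    forall z, (forall i, (i < n)%N -> b i z = a i z) -> x' z = x z].
Proof.
move=> r0 er ca cb cx ab xa.
exists (fun z => push n r (a^~ z) (b^~ z) (x z)); split.
- by move=> z; apply: cvg_push => [i i_n|i i_n|]; [exact: ca|exact: cb|exact: cx].
- move=> z j jn; case: (ab z) => [E|[sep close]].
    by rewrite push_id// E//; exact: xa.
  rewrite -(@push_center _ _ n r (a^~ z) (b^~ z) j)//; last first.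
    by move=> i i_n ij; exact: sep.
  apply/eqP => /(push_inj r0 er close) /eqP; apply/negP; exact: xa.
- by move=> z E; rewrite push_id.
Qed.

(** The existence of an avoiding strand is locally constant in the time [u]: configurations at
    nearby times are uniformly close over [C] and equal off [C], so [avoid_push] leads from one to
    the other. *)
Lemma avoid_homotopy (Z : topologicalType) (C : set Z) n
    (G : nat -> R -> Z -> V) (x : Z -> V) (u0 u1 : R) :
  compact C ->
  (forall i, (i < n)%N -> continuous (fun p : R * Z => G i p.1 p.2)) ->
  (forall u z, distinct n (fun i => G i u z)) ->
  (forall u v z i, ~ C z -> (i < n)%N -> G i u z = G i v z) ->
  continuous x -> (forall z i, (i < n)%N -> x z != G i u0 z) ->
  exists x', [/\ continuous x', forall z i, (i < n)%N -> x' z != G i u1 z &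
    forall z, (forall u v i, (i < n)%N -> G i u z = G i v z) -> x' z = x z].
Proof.
move=> cC cG dG sG cx xG.
pose P u := exists x', [/\ continuous x', forall z i, (i < n)%N -> x' z != G i u z &
    forall z, (forall u v i, (i < n)%N -> G i u z = G i v z) -> x' z = x z].
apply: (@locally_constant_prop R P u0 u1); last by exists x.
have cGu u i : (i < n)%N -> continuous (G i u).
  move=> i_n z; apply: (@continuous_comp _ _ _ (pair u) (fun p => G i p.1 p.2)).
    by apply: (@cvg_pair _ _ _ (nbhs z) (nbhs u) (nbhs z)); [exact: cvg_cst|exact: cvg_id].
  exact: cG.
move=> u; have [r r0 sep] := @uniform_separation Z C n (fun i => G i u) cC
  (cGu u) (fun z _ => dG u z).
(* The factor 4 gives [n%:R * e < r / 2], for injectivity, and [2 * e <= r / 2], so that strands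
   moved by less than [e] stay [r / 2] apart. Hence the step works from [u] to [v] and back. *)
pose e := r / (4 * n.+1%:R).
have n0 : 0 < n.+1%:R :> R by rewrite ltr0n.
have e0 : 0 < e by rewrite divr_gt0// mulr_gt0.
have rE : r = e * (4 * n.+1%:R) by rewrite /e divfK// gt_eqF// mulr_gt0.
have n1 : 1 <= n.+1%:R :> R by rewrite ler1n.
have nE : n.+1%:R = n%:R + 1 :> R by rewrite -natr1.
have nn : 0 <= n%:R :> R by rewrite ler0n.
have er : n%:R * e < r / 2 by rewrite rE nE; nra.
have re : 2 * e <= r / 2 by rewrite rE; nra.
have : \forall v \near u, forall i : 'I_n, forall z, C z -> `|G i v z - G i u z| < e.
  apply: (@filter_forall R 'I_n (fun i => [set v |
    forall z, C z -> `|G i v z - G i u z| < e]) (nbhs u)) => i.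
  apply: (@compact_uniform_near R Z C (G i) u e) => // z Cz.
  by apply: (cG i _ (u, z)).
apply: filterS => v close.
have step a b : (a = u /\ b = v) \/ (a = v /\ b = u) -> P a -> P b.
  move=> abuv [y [cy ya yx]].
  have [||||z|z i i_n|y' [cy' y'b y'y]] :=
    @avoid_push Z n (r / 2) e (fun i => G i a) (fun i => G i b) y _ er.
  - lra.
  - exact: cGu.
  - exact: cGu.
  - exact: cy.
  - have [Cz|nCz] := pselect (C z); [right|by left => i; exact: sG].
    have cl i (i_n : (i < n)%N) := close (Ordinal i_n) z Cz.
    split=> [i k i_n kn ik|i i_n].
      have := sep z i k Cz i_n kn ik; have := cl i i_n; have := cl k kn.
      rewrite /=; case: abuv => -[-> _]; first by lra.
      move=> h1 h2 h3; have := ler_distD (G i v z) (G i u z) (G k u z).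
      have := ler_distD (G k v z) (G i v z) (G k u z).
      by move: h2; rewrite (distrC (G i v z) (G i u z)); lra.
    by have := cl i i_n; case: abuv => -[-> ->] /ltW //; rewrite distrC.
  - exact: ya.
  exists y'; split=> // z zs; rewrite y'y ?yx// => i i_n; exact: zs.
by split; apply: step; [left|right].
Qed.

End Configurations.

(** * Extending a homotopy of braids by one strand *)

Lemma cvg_minr (R : realType) (T : Type) (F : set_system T) {FF : Filter F}
    (f g : T -> R) (l m : R) :
  f @ F --> l -> g @ F --> m -> (fun t => Num.min (f t) (g t)) @ F --> Num.min l m.
Proof.
move=> fl gm; rewrite minr_absE.
rewrite (_ : (fun t => _) = (fun t => (f t + g t - `|f t - g t|) / 2)); last first.
  by apply/funext => t; rewrite minr_absE.
apply: cvgMr_tmp; apply: cvgB; first exact: cvgD.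
by apply: cvg_norm; exact: cvgB.
Qed.

Section Disc.
Context {R : realType}.
Local Notation V := (R * R)%type.
Implicit Types (x y z : V).

(** The norm of [R * R] is the maximum norm, so the unit disc is a square. Maps on it are encoded as
    maps [f] on the plane with [f (retract z) = f z]; their values at points of norm at least 1 are
    the boundary values. *)
Definition retract z : V := (Num.max 1 `|z|)^-1 *: z.

Let max1_gt0 (t : R) : 0 < Num.max 1 t.
Proof. by rewrite lt_max ltr01. Qed.

Lemma retract_continuous : continuous retract.
Proof.
move=> z; apply: cvgZ => //; apply: cvgV; first by rewrite gt_eqF.
by apply: cvg_maxr; [exact: cvg_cst|apply: cvg_norm; exact: cvg_id].
Qed.

Lemma retract_id z : `|z| <= 1 -> retract z = z.
Proof. by move=> z1; rewrite /retract max_l// invr1 scale1r. Qed.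

Lemma norm_retract z : `|retract z| <= 1.
Proof.
by rewrite normrZ gtr0_norm ?invr_gt0// mulrC ler_pdivrMr// mul1r le_max lexx orbT.
Qed.

Lemma retract_scale (l : R) z :
  0 <= l -> 1 <= `|z| -> 1 <= `|l *: z| -> retract (l *: z) = retract z.
Proof.
move=> l0 z1 lz1; have l_gt0 : 0 < l.
  rewrite lt_neqAle l0 andbT eq_sym; apply/eqP => lE.
  by move: lz1; rewrite lE scale0r normr0 ler10.
rewrite /retract max_r// max_r// normrZ ger0_norm// scalerA.
by rewrite invfM mulrAC mulVf ?mul1r// gt_eqF.
Qed.

Lemma norm_retract_out z : 1 <= `|z| -> `|retract z| = 1.
Proof.
move=> z1; rewrite normrZ gtr0_norm ?invr_gt0// max_r// mulVf// gt_eqF//.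
exact: lt_le_trans z1.
Qed.

Lemma compact_disc (r : R) : compact [set z : V | `|z| <= r].
Proof.
have -> : [set z : V | `|z| <= r] = `[- r, r]%classic `*` `[- r, r]%classic.
  apply/seteqP; split=> [[a b]|[a b]] /=; rewrite /Num.norm/= ge_max !ler_norml !in_itv/=.
    by move=> /andP[].
  by move=> [-> ->].
by apply: compact_setX; exact: segment_compact.
Qed.

Lemma escape_ray n (e : nat -> V) (y : V) :
  (forall i, (i < n)%N -> y != e i) ->
  exists v : V, forall s : R, 0 <= s ->
    s - `|y| <= `|y + s *: v| /\ forall i, (i < n)%N -> y + s *: v != e i.
Proof.
(* [t] exceeds the absolute slope of every line from [y] to a point [e i]. A vertical line
   contributes 0 through division by zero, which is harmless because the ray moves in the first
   coordinate. *)
move=> ye; pose t := 1 + \sum_(i < n) `|((e i).2 - y.2) / ((e i).1 - y.1)|.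
exists (1, t) => s s0; split.
  have h1 : `|(y + s *: (1, t)).1| <= `|y + s *: (1, t)|.
    by rewrite [leRHS]/Num.norm /= le_max lexx.
  have h2 : `|y.1| <= `|y| by rewrite [leRHS]/Num.norm /= le_max lexx.
  apply: le_trans h1 => /=; rewrite [s *: _]mulr1.
  have := ler_norm (y.1 + s); have := ler_norm (- y.1); rewrite normrN; lra.
move=> i i_n; apply/eqP => E.
have E1 : (e i).1 - y.1 = s by rewrite -E /= [s *: _]mulr1 addrC addKr.
have E2 : (e i).2 - y.2 = s * t by rewrite -E /= addrC addKr.
have [s_eq0|sN0] := eqVneq s 0.
  by move: (ye i i_n); rewrite -E s_eq0 scale0r addr0 eqxx.
suff : `|t| < t by rewrite ltNge ler_norm.
rewrite {2}/t (bigD1 (Ordinal i_n))//= E1 E2 mulrAC divff// mul1r.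
rewrite addrCA ltrDl ltr_pwDl// sumr_ge0//.
Qed.

Lemma disc_bound (f : V -> V) : continuous f -> (forall z, f (retract z) = f z) ->
  exists M, forall z, `|f z| <= M.
Proof.
move=> cf fr.
have : compact (f @` [set z : V | `|z| <= 1]).
  apply: continuous_compact; last exact: compact_disc.
  exact: continuous_subspaceT.
move=> /compact_bounded [M [_ MP]]; exists (M + 1) => z.
rewrite -fr; apply: MP; first by rewrite ltrDl.
by exists (retract z) => //; exact: norm_retract.
Qed.

Lemma disc_bound_family n (f : nat -> V -> V) :
  (forall i, (i < n)%N -> continuous (f i)) ->
  (forall i z, (i < n)%N -> f i (retract z) = f i z) ->
  exists M, forall i z, (i < n)%N -> `|f i z| <= M.
Proof.
elim: n => [|n IH] cf fr; first by exists 0.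
have [|i z i_n|M MP] := IH.
- by move=> i i_n; apply: cf; exact: ltnW.
- by apply: fr; exact: ltnW.
have [N NP] := disc_bound (cf n (ltnSn n)) (fun z => fr n z (ltnSn n)).
exists (Num.max M N) => i z; rewrite ltnS leq_eqVlt => /orP[/eqP ->|i_n].
  by rewrite le_max NP orbT.
by rewrite le_max MP.
Qed.

End Disc.

Section ExtendStrand.
Context {R : realType}.
Local Notation V := (R * R)%type.

Let max1_gt0 (t : R) : 0 < Num.max 1 t.
Proof. by rewrite lt_max ltr01. Qed.

(** The last strand of [h'] avoids the other strands of [h'], not those of [h]. A strand avoiding
    [G] at time 0, which runs through both, is written down explicitly and carried to [h] by
    [avoid_homotopy]. *)
Lemma extend_strand n (h h' : nat -> V -> V) :
  (forall i, (i < n)%N -> continuous (h i)) ->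
  (forall i, (i < n.+1)%N -> continuous (h' i)) ->
  (forall z, distinct n (h^~ z)) -> (forall z, distinct n.+1 (h'^~ z)) ->
  (forall i z, (i < n)%N -> h i (retract z) = h i z) ->
  (forall i z, (i < n.+1)%N -> h' i (retract z) = h' i z) ->
  (forall i (z : V), (i < n)%N -> 1 <= `|z| -> h i z = h' i z) ->
  exists x : V -> V, [/\ continuous x, forall z, x (retract z) = x z,
    forall z i, (i < n)%N -> x z != h i z &
    forall z : V, 1 <= `|z| -> x z = h' n z].
Proof.
move=> ch ch' dh dh' hr h'r hh'.
have nS i : (i < n)%N -> (i < n.+1)%N by move=> /ltnW.
(* [G] at time [0], read inwards from radius 4: [h'] down to its centre, a rest
   between radii 3 and 2, [h'] backwards, and [h] inside the unit disc.  At time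
   [1] it is [h]. *)
pose k (r : R) : R := Num.max (Num.max (2 - r) (r - 3)) 0.
pose l (u : R) (z : V) : R :=
  Num.min 1 (Num.max (k `|z|) (Num.min 1 u) / Num.max 1 `|z|).
pose G i (u : R) z : V := h i z - h' i z + h' i (l u z *: z).
have ck (T : Type) (F : set_system T) (FF : Filter F) (f : T -> R) a :
    f @ F --> a -> (fun t => k (f t)) @ F --> k a.
  move=> fa; apply: cvg_maxr; last exact: cvg_cst.
  by apply: cvg_maxr; apply: cvgB => //; exact: cvg_cst.
have cl : continuous (fun p : R * V => l p.1 p.2).
  move=> [u z]; apply: cvg_minr; first exact: cvg_cst.
  have cn : `|p.2| @[p --> (u, z)] --> `|z| by apply: cvg_norm; exact: cvg_snd.
  apply: cvgM; last first.
    apply: cvgV; first by rewrite gt_eqF.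
    by apply: cvg_maxr => //; exact: cvg_cst.
  apply: cvg_maxr; first exact: ck.
  by apply: cvg_minr; [exact: cvg_cst|exact: cvg_fst].
have cG i : (i < n)%N -> continuous (fun p : R * V => G i p.1 p.2).
  move=> i_n p; apply: cvgD.
    apply: cvgB.
      by apply: (@continuous_comp _ _ _ snd (h i)); [exact: cvg_snd|exact: ch].
    by apply: (@continuous_comp _ _ _ snd (h' i)); [exact: cvg_snd|exact/ch'/nS].
  apply: (@continuous_comp _ _ _ (fun p : R * V => l p.1 p.2 *: p.2) (h' i)).
    by apply: cvgZ; [exact: cl|exact: cvg_snd].
  exact/ch'/nS.
have k0 r : 0 <= k r by rewrite /k le_max lexx orbT.
have l0 u z : 0 <= l u z.
  by rewrite /l le_min ler01/= divr_ge0//; [rewrite le_max k0|exact: ltW].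
have l_in u (z : V) : `|z| <= 1 -> l u z = 1.
  move=> z1; rewrite /l (max_l z1) divr1 min_l// /k !le_max.
  by apply/orP; left; apply/orP; left; apply/orP; left; lra.
(* Inside the disc the two terms in [h'] cancel, outside it [h] and the first [h'] do; the single
   formula glues both regions continuously. *)
have G_in i u (z : V) : (i < n)%N -> `|z| <= 1 -> G i u z = h i z.
  by move=> i_n z1; rewrite /G l_in// scale1r subrK.
have G_out i u (z : V) : (i < n)%N -> 1 <= `|z| -> G i u z = h' i (l u z *: z).
  by move=> i_n z1; rewrite /G hh'// subrr add0r.
(* Once this maximum is at least 1, [l u z *: z] has norm at least 1, so [h'] takes its boundary
   value there, which is that of [h]. *)
have G_frame i u (z : V) : (i < n)%N -> 1 <= `|z| -> 1 <= Num.max (k `|z|) (Num.min 1 u) ->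
    G i u z = h i z.
  move=> i_n z1 m1; rewrite G_out// -h'r ?nS// retract_scale ?h'r ?nS ?hh'//.
  rewrite normrZ ger0_norm// /l (max_r z1) minr_pMl ?normr_ge0// mul1r.
  by rewrite divfK ?le_min ?z1// gt_eqF//; exact: lt_le_trans z1.
have dG u z : distinct n (fun i => G i u z).
  move=> i j i_n jn ij; case: (leP `|z| 1) => z1.
    by rewrite !G_in//; exact: dh.
  by rewrite !G_out ?ltW//; apply: dh' => //; exact: nS.
have kfar (z : V) : 4 <= `|z| -> 1 <= k `|z|.
  by move=> z4; rewrite /k !le_max; apply/orP; left; apply/orP; right; lra.
have G_stat u (z : V) i : 4 <= `|z| -> (i < n)%N -> G i u z = h i z.
  by move=> z4 i_n; apply: G_frame => //; [lra|rewrite le_max kfar].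
have G1 i z : (i < n)%N -> G i 1 z = h i z.
  move=> i_n; case: (leP `|z| 1) => z1; first by rewrite G_in.
  by apply: G_frame => //; [exact: ltW|rewrite le_max minxx lexx orbT].
have [M MP] := disc_bound_family ch hr.
have [M' MP'] := disc_bound_family ch' h'r.
pose y := h' n 0.
have [|v vP] := @escape_ray R n (fun i => h' i 0) y.
  move=> i i_n; apply: dh' => //; first exact: nS.
  by rewrite gtn_eqF.
(* [M] and [M'] bound the strands of [h] and [h'], so [y + S *: v] has larger norm than every strand
   of [G]. *)
pose S := `|y| + Num.max M M' + 1.
have S0 : 0 <= S.
  have M'0 : 0 <= M' by apply: le_trans (normr_ge0 y) _; exact: MP'.
  by rewrite /S -addrA addr_ge0// addr_ge0// le_max M'0 orbT.
(* From radius 4 inwards to 3, [x0] follows the last strand of [h'] to [y]; between 3 and 2 it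
   leaves along [v] while the other strands rest at [h' i 0]; inside radius 2 it waits at
   [y + S *: v]. *)
pose mu (z : V) : R := Num.max 0 (`|z| - 3) / Num.max 1 `|z|.
pose sg (z : V) : R := S * Num.max 0 (Num.min 1 (3 - `|z|)).
pose x0 z : V := h' n (mu z *: z) + sg z *: v.
have sg0 z : 0 <= sg z by rewrite mulr_ge0// le_max lexx.
have cx0 : continuous x0.
  move=> z; have cn : `|p| @[p --> z] --> `|z| by apply: cvg_norm; exact: cvg_id.
  apply: cvgD.
    apply: (@continuous_comp _ _ _ (fun z => mu z *: z) (h' n)); last exact: ch'.
    apply: cvgZ; last exact: cvg_id.
    apply: cvgM.
      apply: cvg_maxr; first exact: cvg_cst.
      by apply: cvgB => //; exact: cvg_cst.
    apply: cvgV; first by rewrite gt_eqF.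
    by apply: cvg_maxr => //; exact: cvg_cst.
  apply: cvgZ; last exact: cvg_cst.
  apply: cvgM; first exact: cvg_cst.
  apply: cvg_maxr; first exact: cvg_cst.
  apply: cvg_minr; first exact: cvg_cst.
  by apply: cvgB => //; exact: cvg_cst.
have mu_in (z : V) : `|z| <= 3 -> mu z = 0.
  by move=> z3; rewrite /mu max_l ?mul0r// subr_le0.
have sg_out (z : V) : 3 <= `|z| -> sg z = 0.
  move=> z3; rewrite /sg max_l ?mulr0// ge_min; apply/orP; right; lra.
have min01 : Num.min 1 0 = 0 :> R by rewrite min_r// ler01.
have x0G (z : V) i : (i < n)%N -> x0 z != G i 0 z.
  move=> i_n; rewrite /x0; case: (leP 3 `|z|) => z3.
    have z1 : 1 <= `|z| by lra.
    rewrite sg_out// scale0r addr0 G_out//.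
    suff -> : l 0 z = mu z by apply: dh' => //; [exact: nS|rewrite gtn_eqF].
    have kE : k `|z| = `|z| - 3.
      by rewrite /k (@max_r _ _ (2 - `|z|)) ?(@max_l _ _ (`|z| - 3)); lra.
    have z30 : 0 <= `|z| - 3 by lra.
    rewrite /l /mu kE min01 (max_l z30) (max_r z30) (max_r z1) min_r//.
    by rewrite ler_pdivrMr; lra.
  rewrite (mu_in _ (ltW z3)) scale0r -/y; case: (leP 2 `|z|) => z2.
    have z1 : 1 <= `|z| by lra.
    rewrite G_out//; suff -> : l 0 z = 0 by rewrite scale0r; apply vP.
    have kE : k `|z| = 0 by rewrite /k max_r// ge_max; apply/andP; split; lra.
    by rewrite /l kE min01 maxxx mul0r min01.
  have -> : sg z = S.
    by rewrite /sg min_l; [rewrite max_r ?mulr1// ler01|lra].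
  apply/eqP => E; have [+ _] := vP S S0; rewrite E leNgt => /negP; apply.
  have GM : `|G i 0 z| <= Num.max M M'.
    case: (leP `|z| 1) => z1; first by rewrite G_in// le_max MP.
    by rewrite (G_out _ _ _ i_n (ltW z1)) le_max MP' ?orbT ?nS.
  by rewrite /S; lra.
have nle4 (z : V) : ~ `|z| <= 4 -> 4 <= `|z|.
  by move=> /negP; rewrite -ltNge => /ltW.
have [|u w z i z4 i_n|x1 [cx1 x1h x1x0]] :=
    @avoid_homotopy R V V [set z : V | `|z| <= 4] n G x0 0 1 _ cG dG _ cx0 x0G.
- exact: compact_disc.
- by rewrite !G_stat//; exact: nle4.
(* [x1] fits [h] with boundary at radius 4; shrink that disc to the unit disc. *)
pose w (t : R) : R := Num.max 1 t.
pose G2 i (t : R) z : V := h i (w t *: z).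
have cG2 i : (i < n)%N -> continuous (fun p : R * V => G2 i p.1 p.2).
  move=> i_n p; apply: (@continuous_comp _ _ _ (fun p : R * V => w p.1 *: p.2) (h i)).
    apply: cvgZ; last exact: cvg_snd.
    by apply: cvg_maxr; [exact: cvg_cst|exact: cvg_fst].
  exact: ch.
have G2_stat t (z : V) i : 1 <= `|z| -> (i < n)%N -> G2 i t z = h i z.
  move=> z1 i_n; rewrite /G2 -hr// retract_scale ?hr//.
    by rewrite /w le_max ler01.
  rewrite normrZ ger0_norm ?(ltW (max1_gt0 _))// -[1]mulr1 ler_pM//.
  by rewrite le_max lexx.
have [||||z i i_n|x2 [cx2 x2h x2x1]] :=
    @avoid_homotopy R V V [set z : V | `|z| <= 1] n G2 (fun z => x1 ((4 : R) *: z)) 4 1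
      _ cG2.
- exact: compact_disc.
- by move=> t z; exact: dh.
- by move=> t s z i /negP; rewrite -ltNge => /ltW z1 i_n; rewrite !G2_stat.
- move=> z; apply: (@continuous_comp V V V (fun z => (4 : R) *: z) x1); last exact: cx1.
  by apply: cvgZ; [exact: cvg_cst|exact: cvg_id].
- rewrite /G2 /w max_r; last by lra.
  by rewrite -G1//; exact: x1h.
have x2h' (z : V) : 1 <= `|z| -> x2 z = h' n z.
  move=> z1; have z4 : 4 <= `|4 *: z|.
    by rewrite normrZ ger0_norm//; lra.
  rewrite x2x1; last by move=> t s i i_n; rewrite !G2_stat.
  rewrite x1x0; last by move=> t s i i_n; rewrite !G_stat.
  rewrite /x0 sg_out ?scale0r ?addr0; last by lra.
  (* With [r] the norm of [z], this point has norm [4 * r - 3], at least 1, and lies on the ray of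
     [z]; so it has the same retraction, and [h' n] takes its boundary value. *)
  have -> : mu (4 *: z) *: (4 *: z) = ((4 * `|z| - 3) / `|z|) *: z.
    rewrite scalerA /mu normrZ ger0_norm// max_r; last by lra.
    rewrite max_r; last by lra.
    by congr (_ *: _); field; apply/eqP; lra.
  rewrite -h'r// retract_scale ?h'r//.
    by rewrite divr_ge0//; lra.
  rewrite normrZ ger0_norm ?divr_ge0//; last by lra.
  by rewrite divfK; [lra|rewrite gt_eqF//; lra].
exists (x2 \o retract); split.
- move=> z; apply: continuous_comp; [exact: retract_continuous|exact: cx2].
- by move=> z /=; rewrite (retract_id (norm_retract z)).
- move=> z i i_n /=; rewrite -hr//.
  by have := x2h (retract z) i i_n; rewrite /G2 /w maxxx scale1r.
- by move=> z z1 /=; rewrite x2h' ?norm_retract_out// h'r.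
Qed.

End ExtendStrand.

(** * The spaces of injections and of paths *)

Lemma cvg_set_type (X : topologicalType) (A : set X) (Y : Type)
    (F : set_system Y) {FF : Filter F} (f : Y -> A) (a : A) :
  (fun y => set_val (f y) : X) @ F --> (set_val a : X) -> f @ F --> a.
Proof.
move=> fa U [_ [[/= W oW <-] Wa WU]].
apply: (filterS WU); apply: fa.
by move: oW; rewrite openE; apply.
Qed.

Section HalfLine.
Context {R : realType}.
Local Notation E := (extended_half_line R).

Lemma half_line_max0 (r : R) : Num.max 0 r \in half_line R.
Proof. by apply/mem_set; rewrite /half_line /= in_itv/= andbT le_max lexx. Qed.

Definition to_half_line (r : R) : half_line R := SigSub (half_line_max0 r).

Lemma to_half_lineE (r : R) : set_val (to_half_line r) = Num.max 0 r.
Proof. by []. Qed.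

Lemma to_half_line_continuous : continuous to_half_line.
Proof.
move=> r; apply: cvg_set_type.
by apply: cvg_maxr; [exact: cvg_cst|exact: cvg_id].
Qed.

Lemma half_line_ge0 (x : half_line R) : 0 <= set_val x.
Proof. by have := set_valP x; rewrite /half_line /= in_itv/= andbT. Qed.

Lemma to_half_lineK (x : half_line R) : to_half_line (set_val x) = x.
Proof. by apply: val_inj => /=; rewrite max_r//; exact: half_line_ge0. Qed.

(** A chart identifying the extended half-line with the unit interval; its inverse [of_unit] is
    continued by constants to the whole real line. *)
Definition to_unit (t : E) : R :=
  if t is Some x then set_val x / (1 + set_val x) else 1.

Definition of_unit (s : R) : E :=
  if s < 1 then Some (to_half_line (s / (1 - s))) else None.

Lemma to_unitK : cancel to_unit of_unit.
Proof.
move=> [x|]; rewrite /to_unit /of_unit ?ltxx//.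
have x0 := half_line_ge0 x; have x1 : 0 < 1 + set_val x by lra.
rewrite ltr_pdivrMr// mul1r ltrDr ltr01.
have -> : 1 - set_val x / (1 + set_val x) = (1 + set_val x)^-1.
  by field; rewrite gt_eqF.
by rewrite invrK divfK ?gt_eqF// to_half_lineK.
Qed.

Lemma to_unit0 : to_unit ehl0 = 0.
Proof. by rewrite /to_unit /= mul0r. Qed.

Lemma of_unit_le0 (s : R) : s <= 0 -> of_unit s = ehl0.
Proof.
move=> s0; rewrite /of_unit ifT; last by lra.
congr Some; apply: val_inj => /=; rewrite max_l//.
by rewrite ler_pdivrMr ?mul0r//; lra.
Qed.

Lemma of_unit_ge1 (s : R) : 1 <= s -> of_unit s = ehloo.
Proof. by move=> s1; rewrite /of_unit ltNge s1. Qed.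

Lemma to_unit_continuous : continuous to_unit.
Proof.
case=> [x|].
  have x0 := half_line_ge0 x.
  suff : {for x, continuous (fun y : half_line R => to_unit (Some y))} by [].
  apply: (@continuous_comp _ R R set_val (fun v => v / (1 + v))).
    exact: (@initial_continuous _ _ set_val).
  have x1 : 1 + set_val x != 0 by rewrite gt_eqF//; lra.
  apply: cvgM; first exact: cvg_id.
  by apply: cvgV => //; apply: cvgD; [exact: cvg_cst|exact: cvg_id].
move=> U /= /nbhs_ballP[e /= e0 eU].
(* Neighbourhoods of infinity contain complements of closed compact sets; beyond [e^-1] the distance
   of [to_unit] to 1 is [(1 + x)^-1 < e]. *)
exists [set x : half_line R | set_val x <= e^-1]; last first.
  move=> t [[y /= /negP]|->]; last exact/eU/ballxx.
  rewrite -ltNge => ye <- /=; apply: eU; rewrite /ball /=.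
  have y0 := half_line_ge0 y; have y1 : 0 < 1 + set_val y by lra.
  rewrite (_ : 1 - _ = (1 + set_val y)^-1); last by field; rewrite gt_eqF.
  rewrite gtr0_norm ?invr_gt0// -[ltRHS]invrK ltf_pV2 ?posrE ?invr_gt0//.
  by apply: lt_trans ye _; lra.
split.
- rewrite (_ : [set x | _] = to_half_line @` `[0, e^-1]%classic).
    apply: continuous_compact; last exact: segment_compact.
    by apply: continuous_subspaceT; exact: to_half_line_continuous.
  apply/seteqP; split=> [x /= xe|_ [r /= + <-]].
    exists (set_val x) => /=; last exact: to_half_lineK.
    by rewrite in_itv/= half_line_ge0.
  by rewrite in_itv/= => /andP[r0 re]; rewrite to_half_lineE max_r.
- apply: (@preimage_closed _ _ (set_val : half_line R -> R) [set r | r <= e^-1]).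
    by move=> x _; exact: (@initial_continuous _ _ set_val).
  exact: closed_le.
Qed.

Lemma of_unit_continuous : continuous of_unit.
Proof.
move=> s U; case: (ltP s 1) => s1.
  rewrite /= {1}/of_unit s1 => nU.
  have : of_unit @ s --> nbhs (Some (to_half_line (s / (1 - s))) : E).
    apply: (@cvg_trans _ ((fun r => Some (to_half_line (r / (1 - r))) : E) @ s)).
      apply: near_eq_cvg; near=> r; rewrite /of_unit ifT//.
      by near: r; exact: lt_nbhsl.
    apply: (@continuous_comp R (half_line R) E
      (fun r => to_half_line (r / (1 - r))) Some); last first.
      exact: one_point_compactification_some_continuous.
    apply: (@continuous_comp R R _ (fun r => r / (1 - r)) to_half_line); last first.
      exact: to_half_line_continuous.
    apply: cvgM; first exact: cvg_id.
    apply: cvgV; first by rewrite gt_eqF//; lra.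
    by apply: cvgB; [exact: cvg_cst|exact: cvg_id].
  by apply.
rewrite /= {1}/of_unit ltNge s1 /= => -[C [cC _] CU].
have : compact ((set_val : half_line R -> R) @` C).
  apply: continuous_compact => //; apply: continuous_subspaceT.
  exact: (@initial_continuous _ _ set_val).
move=> /compact_bounded[M [_ MP]].
(* [C] lies below [N], and for [r < 1] the inequality [r > N / (1 + N)] forces [r / (1 - r) > N], so
   [of_unit r] lies outside [C]. *)
pose N := Num.max 0 M + 1.
have N0 : 0 < N by rewrite ltr_wpDl// le_max lexx.
have NP x : C x -> set_val x <= N.
  move=> Cx; apply: le_trans (ler_norm _) _; apply: MP; last by exists x.
  rewrite /N; have : M <= Num.max 0 M by rewrite le_max lexx orbT.
  by lra.
have N1 : 0 < 1 + N by lra.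
suff : \forall r \near s, U (of_unit r) by [].
near=> r; apply: CU; rewrite /of_unit; case: (ltP r 1) => r1; last by right.
left; exists (to_half_line (r / (1 - r))) => // /NP /=; apply/negP; rewrite -ltNge.
rewrite lt_max; apply/orP; right; rewrite ltr_pdivlMr; last by lra.
have : N / (1 + N) < r.
  near: r; apply: lt_nbhsr; apply: lt_le_trans s1; rewrite ltr_pdivrMr//; lra.
rewrite ltr_pdivrMr//; lra.
Unshelve. all: by end_near. Qed.

Lemma compact_extended_half_line : compact [set: E].
Proof. exact: one_point_compactification_compact. Qed.

End HalfLine.

Section Strands.
Context {R : realType}.
Local Notation V := (R * R)%type.
Local Notation E := (extended_half_line R).
Local Notation X := (Xspace R).

Lemma Zplus_point_subproof i : (i.+1%:R, 0) \in (@Zplus R).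
Proof. by apply/mem_set; exists i.+1. Qed.

(** Strands are numbered from 0, the points of $Z^+$ from 1. *)
Definition zpoint i : (@Zplus R) := SigSub (Zplus_point_subproof i).

Lemma zpointE i : set_val (zpoint i) = (i.+1%:R, 0) :> V.
Proof. by []. Qed.

Lemma zpoint_surj (z : (@Zplus R)) : exists i, z = zpoint i.
Proof.
have [[|i] [// _ zE]] := set_valP z.
by exists i; apply: val_inj; exact: zE.
Qed.

(** Distinct points of $Z^+$ are at distance at least 1; this later makes endpoints at infinity
    locally constant. *)
Lemma zpoint_dist i j : `|set_val (zpoint i) - set_val (zpoint j) : V| < 1 -> i = j.
Proof.
rewrite !zpointE /Num.norm/= gt_max => /andP[+ _].
rewrite ltr_norml.
rewrite -[X in -1 < X < 1]/(i.+1%:R - j.+1%:R : R).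
case: (ltngtP i j) => // ij; rewrite -(ler_nat R) -natr1 in ij.
  by rewrite -!natr1 => /andP[h1 h2]; exfalso; lra.
by rewrite -!natr1 => /andP[h1 h2]; exfalso; lra.
Qed.

Lemma zpoint_inj : injective zpoint.
Proof. by move=> i j ij; apply: zpoint_dist; rewrite ij subrr normr0. Qed.

Lemma nbhs_zpoint i : nbhs (zpoint i) [set zpoint i].
Proof.
have : {for zpoint i, continuous (set_val : (@Zplus R) -> V)}.
  exact: (@initial_continuous _ _ set_val).
move=> /cvgr_dist_lt/(_ 1 ltr01); apply: filterS => z.
by have [j ->] := zpoint_surj z => /zpoint_dist ->.
Qed.

Lemma Zplus_continuous (T : topologicalType) (h : (@Zplus R) -> T) : continuous h.
Proof.
move=> z U; have [i ->] := zpoint_surj z => /nbhs_singleton Ui.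
by apply: filterS (nbhs_zpoint i) => _ ->.
Qed.

Definition strandX (x : X) (i : nat) : V := set_val x (zpoint i).

Lemma strandX_inj (x : X) : injective (strandX x).
Proof. by move=> i j /(set_valP x) /zpoint_inj. Qed.

Lemma strandX_ext (x y : X) : strandX x =1 strandX y -> x = y.
Proof.
move=> xy; apply: val_inj; apply/funext => z.
by have [i ->] := zpoint_surj z; exact: xy.
Qed.

Lemma strandX_ex (a : nat -> V) : injective a -> exists x : X, strandX x =1 a.
Proof.
move=> ai; have /choice[idx idxP] := zpoint_surj.
pose f : {compact-open, (@Zplus R) -> V} := a \o idx.
have fP : f \in (@injections R).
  apply/mem_set => z w /ai zw; by rewrite (idxP z) (idxP w) zw.
exists (SigSub fP) => i; rewrite /strandX /= /f/=.
by congr a; apply: zpoint_inj; rewrite -idxP.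
Qed.

Lemma strandX_continuous i : continuous (strandX^~ i).
Proof.
move=> x; apply: (@continuous_comp X {compact-open, (@Zplus R) -> V} V set_val
    (fun f => f (zpoint i))).
  exact: (@initial_continuous _ _ set_val).
move=> U; rewrite nbhsE => -[O [oO Ox] OU].
have : nbhs (set_val x) [set g : {compact-open, (@Zplus R) -> V} | g @` [set zpoint i] `<=` O].
  apply: open_nbhs_nbhs; split; last by move=> _ [_ -> <-].
  by apply: compact_open_open => //; exact: compact_set1.
by apply: filterS => g gO; apply: OU; apply: gO; exists (zpoint i).
Qed.

(** The points of $Z^+$ are open, so compact-open convergence in [X] reduces to convergence at each
    point. *)
Lemma cvg_strandX (Y : Type) (F : set_system Y) {FF : Filter F} (f : Y -> X) (x : X) :
  (forall i, strandX (f y) i @[y --> F] --> strandX x i) -> f @ F --> x.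
Proof.
move=> fx; apply: cvg_set_type; apply/compact_open_cvgP => C O cC oO xO.
suff : \forall y \near F, C `<=` [set z | O (set_val (f y) z)].
  by apply: filterS => y CO _ [z Cz <-]; exact: CO.
apply: (iffLR (compact_near_coveringP C) cC) => // z Cz.
have [i zE] := zpoint_surj z.
have Oi : nbhs (strandX x i) O.
  by apply: open_nbhs_nbhs; split=> //; apply: xO; exists z => //; rewrite zE.
exists ([set zpoint i], [set y | O (strandX (f y) i)]) => /=.
  by split; [rewrite zE; exact: nbhs_zpoint|exact: fx].
by move=> [w y] /= [-> ].
Qed.

Local Notation K := (set_type (@paths_into R _ (@id_Zplus R) (@H_Zplus R))).

Definition strand (f : K) (i : nat) (t : E) : V := strandX (set_val f t) i.

Lemma strand_inj (f : K) t i j : strand f i t = strand f j t -> i = j.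
Proof. exact: strandX_inj. Qed.

Lemma strand0 (f : K) i : strand f i ehl0 = set_val (zpoint i).
Proof. by have [_ f0 _] := set_valP f; exact: (congr1 (strandX^~ i) f0). Qed.

Lemma strand_ext (f g : K) : (forall i, strand f i =1 strand g i) -> f = g.
Proof.
move=> fg; apply: val_inj; apply/funext => t; apply: strandX_ext => i.
exact: fg.
Qed.

Lemma strand_continuous (f : K) i : continuous (strand f i).
Proof.
have [cf _ _] := set_valP f.
move=> t; apply: (@continuous_comp E X V (set_val f) (strandX^~ i)); first exact: cf.
exact: strandX_continuous.
Qed.

Lemma strandoo (f : K) : exists s : nat -> nat,
  bijective s /\ forall i, strand f i ehloo = set_val (zpoint (s i)).
Proof.
have [_ _ [h [_ [g [_ hK gK]]] fh]] := set_valP f.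
have /choice[idx idxP] := zpoint_surj.
exists (idx \o h \o zpoint); split=> [|i] /=; last by rewrite -idxP -fh.
exists (idx \o g \o zpoint) => i /=; apply: zpoint_inj; rewrite -!idxP.
  by rewrite hK.
by rewrite gK.
Qed.

Lemma strand_ex (S : nat -> E -> V) (s : nat -> nat) :
  (forall i, continuous (S i)) -> (forall t, injective (S^~ t)) ->
  (forall i, S i ehl0 = set_val (zpoint i)) -> bijective s ->
  (forall i, S i ehloo = set_val (zpoint (s i))) ->
  exists f : K, forall i, strand f i =1 S i.
Proof.
move=> cS iS S0 [s' sK s'K] Soo.
have /choice[f fS] : forall t, exists x : X, strandX x =1 S^~ t.
  by move=> t; exact: strandX_ex.
have /choice[idx idxP] := zpoint_surj.
have idxK i : idx (zpoint i) = i by apply: zpoint_inj; rewrite -idxP.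
pose f' : {compact-open, E -> X} := f.
have fP : f' \in paths_into (@id_Zplus R) (@H_Zplus R).
  apply/mem_set; split.
  - move=> t; apply: (@cvg_strandX E (nbhs t) (nbhs_filter t) f) => i; rewrite fS.
    rewrite (_ : (fun y => _) = S i); first exact: cS.
    by apply/funext => y; rewrite fS.
  - by apply: strandX_ext => i; rewrite fS S0.
  - exists (zpoint \o s \o idx).
      split; first exact: Zplus_continuous.
      exists (zpoint \o s' \o idx); split; first exact: Zplus_continuous.
        by move=> z /=; rewrite idxK sK -idxP.
      by move=> z /=; rewrite idxK s'K -idxP.
    move=> z; have [i ->] := zpoint_surj z; rewrite /= idxK -Soo; exact: fS.
by exists (SigSub fP) => i t; exact: fS.
Qed.

Lemma cvg_strand (Y : Type) (F : set_system Y) {FF : Filter F} (f : Y -> K) (g : K) :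
  (forall i t0, strand (f p.2) i p.1 @[p --> (nbhs t0, F)] --> strand g i t0) ->
  f @ F --> g.
Proof.
move=> fg; apply: cvg_set_type; apply/compact_open_cvgP => C O cC oO gO.
suff : \forall y \near F, C `<=` [set t | O (set_val (f y) t)].
  by apply: filterS => y CO _ [z Cz <-]; exact: CO.
apply: (iffLR (compact_near_coveringP C) cC) => // t Ct.
have : (fun p => set_val (f p.2) p.1) @ (nbhs t, F) --> (set_val g t : X).
  by apply: cvg_strandX => i; exact: fg.
by apply; apply: open_nbhs_nbhs; split=> //; apply: gO; exists t.
Qed.

(** Evaluation is jointly continuous because the extended half-line is locally compact: the chart
    [to_unit] cuts out a compact neighbourhood [C] of [t]. *)
Lemma strand_continuous2 i : continuous (fun p : K * E => strand p.1 i p.2).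
Proof.
move=> [f t]; have [cf _ _] := set_valP f.
apply: (@continuous_comp (K * E)%type X V (fun p => set_val p.1 p.2) (strandX^~ i));
  last exact: strandX_continuous.
move=> U /=; rewrite nbhsE => -[O [oO Oft] OU].
have : {for to_unit t, continuous (fun s => set_val f (of_unit s) : X)}.
  apply: (@continuous_comp R E X of_unit (set_val f)); first exact: of_unit_continuous.
  exact: cf.
move=> /(_ O) /=; rewrite to_unitK => /(_ (open_nbhs_nbhs (conj oO Oft))).
move=> /nbhs_ballP[e /= e0 eO].
pose C := to_unit @^-1` [set s | `|to_unit t - s| <= e / 2].
have cC : compact C.
  apply: (@subclosed_compact _ _ [set: E]) => //; last exact: compact_extended_half_line.
  apply: preimage_closed; first by move=> ? _; exact: to_unit_continuous.
  apply: (@preimage_closed _ _ (fun s => `|to_unit t - s|) [set r | r <= e / 2]).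
    move=> s _; apply: cvg_norm; apply: cvgB; [exact: cvg_cst|exact: cvg_id].
  exact: closed_le.
exists ([set g : K | set_val g @` C `<=` O], C) => /=; last first.
  by move=> [g t'] [/= gO Ct']; apply: OU; apply: gO; exists t'.
split.
  have cv : {for f, continuous (set_val : K -> {compact-open, E -> X})}.
    exact: (@initial_continuous _ _ set_val).
  apply: (cv [set g | g @` C `<=` O]); apply: open_nbhs_nbhs; split; first exact: compact_open_open.
  move=> _ [t' Ct' <-]; rewrite -[t']to_unitK; apply: eO.
  by rewrite /ball /=; apply: le_lt_trans Ct' _; lra.
have e20 : 0 < e / 2 by lra.
have /cvgrPdist_lt/(_ _ e20) := @to_unit_continuous R t.
by apply: filterS => t' /ltW.
Qed.

End Strands.

(** * Equivalence of braids on finitely many strands *)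

Section PathsOfBraids.
Context {R : realType}.
Local Notation V := (R * R)%type.
Local Notation E := (extended_half_line R).
Local Notation K := (set_type (@paths_into R _ (@id_Zplus R) (@H_Zplus R))).
Implicit Types (f g p : K) (n : nat).

Definition clamp (u : R) : R := Num.max 0 (Num.min 1 u).

Lemma clamp_continuous : continuous clamp.
Proof.
move=> u; apply: cvg_maxr; first exact: cvg_cst.
by apply: cvg_minr; [exact: cvg_cst|exact: cvg_id].
Qed.

Lemma clamp_itv u : 0 <= clamp u <= 1.
Proof. by rewrite /clamp le_max lexx ge_max ler01/= ge_min lexx. Qed.

Lemma clamp_id u : 0 <= u <= 1 -> clamp u = u.
Proof. by move=> /andP[u0 u1]; rewrite /clamp min_r// max_r. Qed.

Lemma path_joined_continuous (T : topologicalType) (x y : T) :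
  path_joined R x y -> exists F : R -> T, [/\ continuous F, F 0 = x & F 1 = y].
Proof.
move=> [g [/subspace_continuousP cg g0 g1]]; exists (g \o clamp); split.
- move=> u U Ugu; have cI v : `[0, 1]%classic (clamp v) by rewrite /= in_itv/= clamp_itv.
  have gU := cg (clamp u) (cI u) U Ugu.
  have : nbhs u (clamp @^-1` [set s | `[0, 1]%classic s -> U (g s)]).
    exact: clamp_continuous gU.
  by apply: filterS => v; apply; exact: cI.
- by rewrite /= clamp_id ?lexx ?ler01.
- by rewrite /= clamp_id ?lexx ?ler01.
Qed.

Lemma path_joined_strands f (S : nat -> R * E -> V) :
  (forall i, continuous (S i)) -> (forall q, injective (S^~ q)) ->
  (forall i u, S i (u, ehl0) = set_val (zpoint i)) ->
  (forall i u, S i (u, ehloo) = strand f i ehloo) ->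
  (forall i t, S i (0, t) = strand f i t) ->
  exists2 g : K, path_joined R f g & forall i t, strand g i t = S i (1, t).
Proof.
move=> cS iS S0 Soo Sf; have [s [sb sE]] := strandoo f.
have /choice[F FS] (u : R) : exists g : K, forall i, strand g i =1 (fun t => S i (u, t)).
  apply: (@strand_ex R _ s) => //.
  - move=> i t; apply: (@continuous_comp _ _ _ (pair u) (S i)); last exact: cS.
    by apply: (@cvg_pair _ _ _ (nbhs t) (nbhs u) (nbhs t)); [exact: cvg_cst|exact: cvg_id].
  - by move=> i; rewrite Soo sE.
exists (F 1); last by move=> i; exact: FS.
exists F; split=> //; last by apply: strand_ext => i t; rewrite FS Sf.
apply: continuous_subspaceT => u.
apply: (@cvg_strand R R (nbhs u) _ F (F u)) => i t.
have E1 : (fun q : E * R => strand (F q.2) i q.1) = S i \o (fun q : E * R => (q.2, q.1)).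
  by apply/funext => q; rewrite FS.
rewrite FS E1; apply: (@continuous_comp _ _ _ (fun q : E * R => (q.2, q.1)) (S i) (t, u)).
  exact: swap_continuous.
exact: cS.
Qed.

Definition agree n f g : Prop := forall i, (i < n)%N -> strand f i =1 strand g i.

Lemma close_strandoo f g i :
  `|strand g i ehloo - strand f i ehloo| < 1 -> strand g i ehloo = strand f i ehloo.
Proof.
have [s [_ sE]] := strandoo f; have [s' [_ s'E]] := strandoo g.
by rewrite sE s'E => /zpoint_dist ->.
Qed.

(** [push] moves the whole plane, so it drags all strands of [p] along as the first [n] go straight
    from [f] to [g]. At times 0 and infinity these strands of [f] and [g] coincide, the latter
    because [e < 1], so the ends of [p] stay fixed. *)
Lemma agree_push n r e f g p : 0 < r -> n%:R * e < r -> e < 1 ->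
  (forall t i k, (i < n)%N -> (k < n)%N -> i != k -> r <= `|strand f i t - strand f k t|) ->
  (forall t i, (i < n)%N -> `|strand g i t - strand f i t| <= e) ->
  agree n p f -> exists2 p', path_joined R p p' & agree n p' g.
Proof.
move=> r0 er e1 sep close pf.
pose b (q : R * E) i : V := strand f i q.2 + clamp q.1 *: (strand g i q.2 - strand f i q.2).
pose S j (q : R * E) : V := push n r ((strand f)^~ q.2) (b q) (strand p j q.2).
have cs (h : K) i : continuous (fun q : R * E => strand h i q.2).
  move=> q; apply: (@continuous_comp _ _ _ snd (strand h i)); first exact: cvg_snd.
  exact: strand_continuous.
have b0 q i : clamp q.1 = 0 \/ strand g i q.2 = strand f i q.2 -> b q i = strand f i q.2.
  by rewrite /b => -[->|->]; rewrite ?scale0r ?subrr ?scaler0 addr0.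
have [|||||p' pp' p'E] := @path_joined_strands p S.
- move=> i q; apply: cvg_push => [j jn|j jn|]; [exact: cs| |exact: cs].
  apply: cvgD; first exact: cs.
  apply: cvgZ; last by apply: cvgB; exact: cs.
  apply: (@continuous_comp _ _ _ fst clamp); first exact: cvg_fst.
  exact: clamp_continuous.
- move=> q i j /(push_inj r0 er) E'; apply: (@strand_inj _ p q.2); apply: E' => k kn.
  rewrite /b addrC addKr normrZ; have /andP[c0 c1] := clamp_itv q.1.
  rewrite ger0_norm// -[e]mul1r ler_pM//; exact: close.
- by move=> i u; rewrite /S push_id ?strand0// => j jn; rewrite b0// !strand0; right.
- move=> i u; rewrite /S push_id// => j jn; rewrite b0//; right.
  by apply: close_strandoo; exact: le_lt_trans (close _ _ jn) e1.
- by move=> i t; rewrite /S push_id// => j jn; rewrite b0//= clamp_id ?lexx ?ler01//; left.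
- exists p' => // i i_n t; rewrite p'E /S /= pf// push_center//.
    by rewrite /b/= clamp_id ?lexx ?ler01// scale1r addrC subrK.
  by move=> j jn ji; exact: sep.
Qed.

Definition transports n f g : Prop :=
  forall p, agree n p f -> exists2 p', path_joined R p p' & agree n p' g.

Lemma near_transports n f :
  \forall g \near f, transports n f g /\ transports n g f.
Proof.
have [r r0 sep] := @uniform_separation R V E [set: E] n (strand f)
  compact_extended_half_line (fun i _ => @strand_continuous R f i)
  (fun t _ i k _ _ ik => contra_neq (@strand_inj R f t i k) ik).
pose e := Num.min (1 / 2) (r / (4 * n.+1%:R)).
have n0 : 0 < n.+1%:R :> R by rewrite ltr0n.
have e0 : 0 < e by rewrite lt_min !divr_gt0// mulr_gt0.
have e1 : e < 1.
  have : e <= 1 / 2 by rewrite ge_min lexx.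
  by move: e0; lra.
have rE : e * (4 * n.+1%:R) <= r.
  by rewrite -ler_pdivlMr ?mulr_gt0// ge_min lexx orbT.
have nE : n.+1%:R = n%:R + 1 :> R by rewrite -natr1.
have nn : 0 <= n%:R :> R by rewrite ler0n.
have er : n%:R * e < r / 2 by move: rE; rewrite nE; nra.
have re : 2 * e <= r / 2 by move: rE; rewrite nE; nra.
have : \forall g \near f, forall i : 'I_n, forall t, [set: E] t ->
    `|strand g i t - strand f i t| < e.
  apply: (@filter_forall K 'I_n (fun i => [set g | forall t, [set: E] t ->
    `|strand g i t - strand f i t| < e]) (nbhs f)) => i.
  apply: (@compact_uniform_near R V K E [set: E] (fun g => strand g i) f e) => //.
    exact: compact_extended_half_line.
  by move=> t _; exact: (@strand_continuous2 R i (f, t)).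
apply: filterS => g close.
have cl i t (i_n : (i < n)%N) : `|strand g i t - strand f i t| < e.
  exact: (close (Ordinal i_n) t I).
split=> p.
- apply: (@agree_push n (r / 2) e) => //; first by lra.
    by move=> t i k i_n kn ik; apply: le_trans (sep t i k I i_n kn ik); lra.
  by move=> t i i_n; exact/ltW/cl.
- apply: (@agree_push n (r / 2) e) => //; first by lra.
    move=> t i k i_n kn ik; have h := sep t i k I i_n kn ik.
    have h1 := cl i t i_n; have h2 := cl k t kn.
    have := ler_distD (strand g i t) (strand f i t) (strand f k t).
    have := ler_distD (strand g k t) (strand g i t) (strand f k t).
    by move: h1; rewrite (distrC (strand g i t) (strand f i t)); lra.
  by move=> t i i_n; rewrite distrC; exact/ltW/cl.
Qed.

(** A homotopy lifting property for the restriction of braids to [n] strands: short moves lift in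
    both directions by [near_transports], hence so does a whole path. *)
Lemma path_joined_transports n f g : path_joined R f g -> transports n f g.
Proof.
move=> /path_joined_continuous[F [cF <- <-]] p pf.
pose P u := exists2 p', path_joined R p p' & agree n p' (F u).
apply: (@locally_constant_prop R P 0 1); last first.
  by exists p => //; exact: path_joined_refl.
move=> u; have : \forall v \near u, transports n (F u) (F v) /\ transports n (F v) (F u).
  exact: cF u _ (near_transports n (F u)).
apply: filterS => v [uv vu]; split=> -[p' pp' p'E].
  by have [q p'q qE] := uv p' p'E; exists q => //; exact: path_joined_trans p'q.
by have [q p'q qE] := vu p' p'E; exists q => //; exact: path_joined_trans p'q.
Qed.

(* [f] and [g] have homotopic restrictions to the first [n] strands. *)
Definition equiv_upto n f g : Prop := exists2 g', path_joined R g g' & agree n g' f.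

Lemma path_joined_equiv_upto n f g : path_joined R f g -> equiv_upto n f g.
Proof. by move=> fg; exists f => //; exact: path_joined_sym. Qed.

Lemma equiv_upto_sym n f g : equiv_upto n f g -> equiv_upto n g f.
Proof.
move=> [g' gg' g'f].
have [|f' ff' f'g] := @path_joined_transports n _ _ (path_joined_sym gg') f.
  by move=> i i_n t; rewrite g'f.
by exists f'.
Qed.

Lemma equiv_upto_trans n f g p : equiv_upto n f g -> equiv_upto n g p -> equiv_upto n f p.
Proof.
move=> [g' gg' g'f] [p' pp' p'g].
have [p'' p'p'' p''g'] := path_joined_transports gg' p'g.
exists p''; first exact: path_joined_trans p'p''.
by move=> i i_n t; rewrite p''g'// g'f.
Qed.

Lemma near_equiv_upto n f : \forall g \near f, equiv_upto n f g.
Proof.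
apply: filterS (near_transports n f) => g [_ gf].
by have [//|g' gg' g'f] := gf g; exists g'.
Qed.

Lemma near_strandoo f i : \forall g \near f, strand g i ehloo = strand f i ehloo.
Proof.
have : {for f, continuous (fun g : K => strand g i ehloo)}.
  move=> U nU; have [[A B] /= [nA nB] AB] := @strand_continuous2 R i (f, ehloo) U nU.
  by apply: filterS nA => g Ag; apply: (AB (g, ehloo)); split=> //; exact: nbhs_singleton.
move=> /cvgr_dist_lt/(_ 1 ltr01); apply: filterS => g.
by rewrite distrC => /close_strandoo.
Qed.

Lemma path_joined_strandoo f g i :
  path_joined R f g -> strand f i ehloo = strand g i ehloo.
Proof.
move=> /path_joined_continuous[F [cF <- <-]].
apply: (@locally_constant_prop R (fun u => strand (F 0) i ehloo = strand (F u) i ehloo) 0 1) => //.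
move=> u; have : \forall v \near u, strand (F v) i ehloo = strand (F u) i ehloo.
  exact: cF u _ (near_strandoo (F u) i).
by apply: filterS => v ->.
Qed.

(** Braids agreeing with [f] on more and more strands form a filter converging to [f], because
    convergence is tested one strand at a time. *)
Lemma nbhs_agree f (U : set K) : nbhs f U -> exists n, forall g, agree n g f -> U g.
Proof.
pose F := filter_from [set: nat] (fun n => [set g | agree n g f]).
have FF : Filter F.
  apply: filter_from_filter; first by exists 0.
  move=> n m _ _; exists (maxn n m) => // g gf.
  by split=> i i_n; apply: gf; rewrite leq_max i_n ?orbT.
have : id @ F --> f.
  apply: cvg_strand => i t A nA.
  have nA' := @strand_continuous R f i t A nA.
  exists ((strand f i) @^-1` A, [set g | agree i.+1 g f]) => /=.
    by split=> //; exists i.+1.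
  by move=> [s g] [/= As gf]; rewrite gf.
by move=> /[apply] -[n _ nU]; exists n.
Qed.

End PathsOfBraids.

(** * Braids equivalent on all finite sets of strands *)

Lemma dependent_choice_indexed (T : Type) (Q : nat -> T -> Prop)
    (S : nat -> T -> T -> Prop) :
  (exists x, Q 0 x) ->
  (forall n x, Q n x -> exists2 y, Q n.+1 y & S n x y) ->
  exists w : nat -> T, forall n, Q n (w n) /\ S n (w n) (w n.+1).
Proof.
move=> [x0 Qx0] step.
have next n (x : {x | Q n x}) : {y : {y | Q n.+1 y} | S n (sval x) (sval y)}.
  apply: cid; case: x => x Qx /=; have [y Qy Sy] := step n x Qx.
  by exists (exist _ y Qy).
pose w := fix w n : {x | Q n x} :=
  if n is m.+1 then sval (next m (w m)) else exist _ x0 Qx0.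
exists (fun n => sval (w n)) => n; split; first exact: svalP.
exact: (svalP (next n (w n))).
Qed.

Lemma continuous_pair (S T U : topologicalType) (f : S -> T) (g : S -> U) (x : S) :
  {for x, continuous f} -> {for x, continuous g} ->
  {for x, continuous (fun s => (f s, g s))}.
Proof.
by move=> cf cg; apply: (@cvg_pair _ _ _ (nbhs x) (nbhs (f x)) (nbhs (g x))).
Qed.

Section Separation.
Context {R : realType}.
Local Notation V := (R * R)%type.
Local Notation E := (extended_half_line R).
Local Notation K := (set_type (@paths_into R _ (@id_Zplus R) (@H_Zplus R))).

Lemma to_unit_ge0 (t : E) : 0 <= to_unit t.
Proof.
case: t => [x|] /=; last exact: ler01.
by rewrite divr_ge0 ?addr_ge0// half_line_ge0.
Qed.

Lemma to_unit_le1 (t : E) : to_unit t <= 1.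
Proof.
case: t => [x|] //=; have x0 := half_line_ge0 x.
by rewrite ler_pdivrMr ?mul1r; lra.
Qed.

(* The square [|z| <= 1] is (homotopy parameter, time), both rescaled to [-1, 1]. *)
Let time (z : V) : E := of_unit ((z.2 + 1) / 2).

Let frame (f g : K) (i : nat) (h : V -> V) : Prop :=
  forall z : V, `|z| <= 1 ->
  [/\ z.1 = -1 -> h z = strand f i (time z), z.1 = 1 -> h z = strand g i (time z),
      z.2 = -1 -> h z = set_val (zpoint i) & z.2 = 1 -> h z = strand f i ehloo].

Let frame_eq f g i h h' (z : V) : frame f g i h -> frame f g i h' ->
  (forall z, h (retract z) = h z) -> (forall z, h' (retract z) = h' z) ->
  1 <= `|z| -> h z = h' z.
Proof.
move=> fh fh' hr h'r z1; rewrite -hr -h'r.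
have [a1 a2 a3 a4] := fh _ (norm_retract z); have [b1 b2 b3 b4] := fh' _ (norm_retract z).
have [c|[c|[c|c]]] : (retract z).1 = -1 \/ (retract z).1 = 1 \/
    (retract z).2 = -1 \/ (retract z).2 = 1.
- move: (retract z) (norm_retract_out z1) => [x y].
  rewrite -[`|(x, y)|]/(Num.max `|x| `|y|).
  case: (leP `|x| `|y|) => _ /=.
    by case: (ler0P y) => _ H; [right; right; left|right; right; right]; lra.
  by rewrite /=; case: (ler0P x) => _ H; [left|right; left]; lra.
- by rewrite a1 ?b1.
- by rewrite a2 ?b2.
- by rewrite a3 ?b3.
- by rewrite a4 ?b4.
Qed.

(** A homotopy rel endpoints from the first [n] strands of [f] to those of [g], encoded by maps
    invariant under [retract]. *)
Let filling f g n (h : nat -> V -> V) : Prop :=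
  [/\ forall i, (i < n)%N -> continuous (h i),
      forall i z, (i < n)%N -> h i (retract z) = h i z,
      forall z, distinct n (h^~ z) & forall i, (i < n)%N -> frame f g i (h i)].

(** A path in [K] from [f] to [f'] is a homotopy of all strands, with constant endpoints at infinity
    since these are locally constant. As [f'] and [g] share their first [n] strands, it has the
    right frame for these. *)
Let equiv_upto_filling f g n :
  equiv_upto n g f -> exists h, filling f g n h.
Proof.
move=> [f' /path_joined_continuous[F [cF F0 F1]] f'g].
have Foo u i : strand (F u) i ehloo = strand f i ehloo.
  rewrite -F0.
  apply: (@locally_constant_prop R
    (fun u => strand (F u) i ehloo = strand (F 0) i ehloo) 0 u) => // v.
  have : \forall w \near v, strand (F w) i ehloo = strand (F v) i ehloo.
    exact: cF v _ (near_strandoo (F v) i).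
  by apply: filterS => w ->.
have half : (1 + 1) / 2 = 1 :> R by lra.
pose k i (z : V) : V := strand (F ((z.1 + 1) / 2)) i (time z).
exists (fun i => k i \o retract); split.
- move=> i _ z; apply: (@continuous_comp V V V retract (k i)).
    exact: retract_continuous.
  apply: (@continuous_comp V (K * E)%type V (fun z => (F ((z.1 + 1) / 2), time z))
    (fun p => strand p.1 i p.2)); last exact: strand_continuous2.
  move: (retract z) => {}z.
  have c1 : {for z, continuous (fun z : V => F ((z.1 + 1) / 2))}.
    apply: (@continuous_comp V R K (fun z => (z.1 + 1) / 2) F); last exact: cF.
    by apply: cvgMr_tmp; apply: cvgD; [exact: cvg_fst|exact: cvg_cst].
  have c2 : {for z, continuous time}.
    apply: (@continuous_comp V R E (fun z => (z.2 + 1) / 2) of_unit);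
      last exact: of_unit_continuous.
    by apply: cvgMr_tmp; apply: cvgD; [exact: cvg_snd|exact: cvg_cst].
  exact: continuous_pair.
- by move=> i z _ /=; rewrite (retract_id (norm_retract z)).
- by move=> z i j _ _ ij /=; exact: contra_neq (@strand_inj R _ _ i j) ij.
- move=> i i_n z z1 /=; rewrite (retract_id z1) /k; split=> [->|->|z2|z2].
  + by rewrite addNr mul0r F0.
  + by rewrite half F1 f'g.
  + by rewrite /time z2 addNr mul0r of_unit_le0// strand0.
  + by rewrite /time z2 half of_unit_ge1// Foo.
Qed.

Lemma equiv_upto_separated (f g : K) : (forall n, equiv_upto n g f) -> path_joined R f g.
Proof.
move=> gf.
(* Each filling extends the previous one by one strand; [gf n.+1] supplies the comparison homotopy
   [h'] for [extend_strand]. *)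
have [||h hP] := @dependent_choice_indexed (nat -> V -> V) (filling f g)
    (fun n h h2 => forall i, (i < n)%N -> h2 i = h i).
- by exists (fun _ _ => 0); split=> // z i k.
- move=> n h [ch hr dh fh].
  have [h' [ch' h'r dh' fh']] := equiv_upto_filling (gf n.+1).
  have [|x [cx xr xh xh']] := extend_strand ch ch' dh dh' hr h'r.
    move=> i z i_n z1; have i_nS : (i < n.+1)%N by exact: ltnW.
    apply: (frame_eq (fh i i_n) (fh' i i_nS)) => // w; [exact: hr|exact: h'r].
  exists (fun i => if (i < n)%N then h i else x); last by move=> i ->.
  split.
  + by move=> i _; case: ifP => // /ch.
  + by move=> i z _; case: ifP => [/hr ->//|_]; exact: xr.
  + move=> z i k; rewrite !ltnS => i_n kn ik; case: (ltnP i n) => i_n'.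
      case: (ltnP k n) => kn'; first exact: dh.
      by rewrite eq_sym; exact: xh.
    case: (ltnP k n) => kn'; first exact: xh.
    by move: ik; rewrite (@anti_leq i n) ?i_n// (@anti_leq k n) ?kn// eqxx.
  + move=> i; rewrite ltnS => i_n; case: (ltnP i n) => i_n'; first exact: fh.
    have -> : i = n by apply: anti_leq; rewrite i_n.
    move=> z z1; have [a1 a2 a3 a4] := fh' n (ltnSn n) z z1.
    have xE : (1 <= `|z.1|) || (1 <= `|z.2|) -> x z = h' n z.
      by move=> zN; apply: xh'; rewrite [leRHS]/(Num.max `|z.1| `|z.2|) le_max.
    split=> zE; rewrite xE ?zE ?normrN ?normr1 ?lexx ?orbT//;
      [exact: a1|exact: a2|exact: a3|exact: a4].
(* Strand [i] first appears in the filling of [i.+1] strands and is kept from then on. *)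
pose H i := h i.+1 i.
have HE m i : (i < m)%N -> h m i = H i.
  elim: m => // m IH; rewrite ltnS leq_eqVlt => /orP[/eqP ->//|im].
  by have [_ ->] := hP m; rewrite ?IH.
have filH m : filling f g m H.
  have [[ch hr dh fh] _] := hP m; split.
  - by move=> i im; rewrite -(HE m)//; exact: ch.
  - by move=> i z im; rewrite -(HE m)//; exact: hr.
  - by move=> z i j im jm; rewrite -!(HE m)//; exact: dh.
  - by move=> i im; rewrite -(HE m)//; exact: fh.
pose S i (q : R * E) : V := H i (2 * clamp q.1 - 1, 2 * to_unit q.2 - 1).
have n1 (q : R * E) : `|(2 * clamp q.1 - 1, 2 * to_unit q.2 - 1) : V| <= 1.
  have /andP[c0 c1] := clamp_itv q.1.
  have t0 := to_unit_ge0 q.2; have t1 := to_unit_le1 q.2.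
  rewrite [leLHS]/(Num.max `|2 * clamp q.1 - 1| `|2 * to_unit q.2 - 1|) ge_max.
  by rewrite !ler_norml; apply/andP; split; apply/andP; split; lra.
have frH i q := let: And4 _ _ _ fr := filH i.+1 in fr i (ltnSn i) _ (n1 q).
have timeE u t : time (u, 2 * to_unit t - 1) = t.
  by rewrite /time /= (_ : _ / 2 = to_unit t) ?to_unitK//; lra.
have c0 : clamp 0 = 0 :> R by rewrite clamp_id// lexx ler01.
have c1 : clamp 1 = 1 :> R by rewrite clamp_id// lexx ler01.
have [|||||g' fg' g'E] := @path_joined_strands R f S.
- move=> i q; have [cH _ _ _] := filH i.+1.
  apply: (@continuous_comp (R * E)%type V V
    (fun q => (2 * clamp q.1 - 1, 2 * to_unit q.2 - 1)) (H i)); last exact: cH.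
  have a1 : {for q, continuous (fun q : R * E => 2 * clamp q.1 - 1)}.
    apply: (@continuous_comp (R * E)%type R R fst (fun u => 2 * clamp u - 1)).
      exact: cvg_fst.
    by apply: cvgB; [apply: cvgMl_tmp; exact: clamp_continuous|exact: cvg_cst].
  have a2 : {for q, continuous (fun q : R * E => 2 * to_unit q.2 - 1)}.
    apply: (@continuous_comp (R * E)%type R R (to_unit \o snd) (fun u => 2 * u - 1)).
      apply: continuous_comp; [exact: cvg_snd|exact: to_unit_continuous].
    by apply: cvgB; [apply: cvgMl_tmp; exact: cvg_id|exact: cvg_cst].
  exact: continuous_pair.
- move=> q i j E1; apply/eqP; apply: contraT => ij.
  have [_ _ dH _] := filH (maxn i j).+1.
  move: (dH (2 * clamp q.1 - 1, 2 * to_unit q.2 - 1) i j).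
  by rewrite !ltnS leq_maxl leq_maxr => /(_ isT isT ij); rewrite -/(S i q) -/(S j q) E1 eqxx.
- move=> i u; have [_ _ fr _] := frH i (u, ehl0); apply: fr.
  by rewrite -[LHS]/(2 * to_unit ehl0 - 1) to_unit0; lra.
- move=> i u; have [_ _ _ fr] := frH i (u, ehloo); apply: fr.
  by rewrite -[LHS]/(2 * 1 - 1 : R); lra.
- move=> i t; have [fr _ _ _] := frH i (0, t).
  rewrite -[RHS]/(strand f i t) -[in RHS](timeE (2 * clamp 0 - 1) t); apply: fr.
  by rewrite -[LHS]/(2 * clamp 0 - 1) c0; lra.
suff -> : g = g' by [].
apply: strand_ext => i t; rewrite g'E; have [_ fr _ _] := frH i (1, t).
rewrite -[in LHS](timeE (2 * clamp 1 - 1) t); apply/esym/fr.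
by rewrite -[LHS]/(2 * clamp 1 - 1) c1; lra.
Qed.

End Separation.

(** * Completeness *)

Section PathComponentQuotient.
Context (R : realType) (T : topologicalType).
Local Open Scope quotient_scope.

Definition component (x : T) : path_components R T := \pi_(path_components R T) x.

Definition component_repr (q : path_components R T) : T := repr q.

Lemma component_reprK q : component (component_repr q) = q.
Proof. exact: reprK. Qed.

Lemma component_eq (x y : T) : component x = component y <-> path_joined R x y.
Proof.
split=> [xy|xy].
  apply/asboolP.
  by have := eqmodP (path_joined_equivRel R T) x y => h; apply/h; exact: xy.
by apply/(eqmodP (path_joined_equivRel R T)); apply/asboolP.
Qed.

Lemma component_open (U : set (path_components R T)) :
  open U <-> open (component @^-1` U).
Proof. by []. Qed.

End PathComponentQuotient.

Section Completeness.
Context {R : realType}.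
Local Notation V := (R * R)%type.
Local Notation E := (extended_half_line R).
Local Notation K := (set_type (@paths_into R _ (@id_Zplus R) (@H_Zplus R))).
Implicit Types (f g p : K).

(* Recording which strands end at the first [n] points makes the limit of a
   Cauchy sequence end in a surjection. *)
Definition same_ends n f g : Prop := forall i j, (j < n)%N ->
  strand f i ehloo = set_val (zpoint j) <-> strand g i ehloo = set_val (zpoint j).

Definition close n f g : Prop := equiv_upto n f g /\ same_ends n f g.

Lemma path_joined_close n f g : path_joined R f g -> close n f g.
Proof.
move=> fg; split; first exact: path_joined_equiv_upto.
by move=> i j _; rewrite (path_joined_strandoo i fg).
Qed.

Lemma close_sym n f g : close n f g -> close n g f.
Proof.
move=> [fg e]; split; first exact: equiv_upto_sym.
by move=> i j jn; split=> /(e i j jn).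
Qed.

Lemma close_trans n f g p : close n f g -> close n g p -> close n f p.
Proof.
move=> [fg e] [gp e']; split; first exact: equiv_upto_trans gp.
by move=> i j jn; rewrite (e i j jn); exact: e'.
Qed.

Lemma closeS n f g : close n.+1 f g -> close n f g.
Proof.
move=> [[g' gg' g'f] e]; split; last by move=> i j jn; apply: e; exact: ltnW.
by exists g' => // i i_n; apply: g'f; exact: ltnW.
Qed.

Lemma near_close n f : \forall g \near f, close n f g.
Proof.
have [s [[s' sK s'K] sE]] := strandoo f.
(* [s' j] is the strand of [f] ending at point [j]. Keeping these [n] endpoints gives [same_ends],
   since by injectivity no other strand of [g] can end there. *)
have : \forall g \near f, forall j : 'I_n, strand g (s' j) ehloo = strand f (s' j) ehloo.
  apply: (@filter_forall K 'I_n (fun j => [set g |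
    strand g (s' j) ehloo = strand f (s' j) ehloo]) (nbhs f)) => j.
  exact: near_strandoo.
move=> H; apply: filterS2 (near_equiv_upto n f) H => g fg gE; split=> // i j jn.
have fj : strand f (s' j) ehloo = set_val (zpoint j) by rewrite sE s'K.
have gj : strand g (s' j) ehloo = set_val (zpoint j) by rewrite -fj; exact: (gE (Ordinal jn)).
split=> E1.
  by have -> : i = s' j by apply: (@strand_inj _ f ehloo); rewrite E1.
by have -> : i = s' j by apply: (@strand_inj _ g ehloo); rewrite E1.
Qed.

Lemma close_complete (u : nat -> K) : (forall n, close n (u n) (u n.+1)) ->
  exists l, forall n, close n (u n) l.
Proof.
move=> uC.
(* The representatives [w n] of the classes of [u n] are chosen so that [w n.+1] agrees with [w n]
   on the first [n] strands; strand [i] is then stable from [w i.+1] on. *)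
have [||w wP] := @dependent_choice_indexed K (fun n w => path_joined R (u n) w)
    (fun n x y => agree n y x).
- by exists (u 0); exact: path_joined_refl.
- move=> n x ux; have [uu _] := uC n.
  have [y uy yx] := equiv_upto_trans
    (path_joined_equiv_upto n (path_joined_sym ux)) uu.
  by exists y.
have uw n : path_joined R (u n) (w n) by case: (wP n).
have wE i m : (i < m)%N -> strand (w m) i =1 strand (w i.+1) i.
  elim: m => // m IH; rewrite ltnS leq_eqVlt => /orP[/eqP ->//|im] t.
  by have [_ wm] := wP m; rewrite wm// IH.
have ends i j m : (j < m)%N ->
    strand (w m) i ehloo = set_val (zpoint j) <->
    strand (w j.+1) i ehloo = set_val (zpoint j).
  rewrite -!(path_joined_strandoo i (uw _)); elim: m => // m IH.
  rewrite ltnS leq_eqVlt => /orP[/eqP ->//|jm].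
  by have [_ e] := uC m; rewrite -(e i j jm); exact: IH.
pose S i : E -> V := strand (w i.+1) i.
have SE i m : (i < m)%N -> strand (w m) i =1 S i by exact: wE.
have Sinj t : injective (S^~ t).
  move=> i j; rewrite -(@SE i (maxn i j).+1) ?ltnS ?leq_maxl//.
  rewrite -(@SE j (maxn i j).+1) ?ltnS ?leq_maxr//; exact: strand_inj.
have /choice[s sE] i : exists k, S i ehloo = set_val (zpoint k).
  by have [s [_ sE]] := strandoo (w i.+1); exists (s i); exact: sE.
have S_ends i j : S i ehloo = set_val (zpoint j) <->
    strand (w j.+1) i ehloo = set_val (zpoint j).
  rewrite -(@SE i (maxn i j).+1) ?ltnS ?leq_maxl//; apply: ends.
  by rewrite ltnS leq_maxr.
(* Stabilization of strands alone would give only an injection at infinity; by [same_ends], the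
   strand of [w j.+1] ending at point [j] still ends there in the limit. *)
have /choice[s' s'E] j : exists i, S i ehloo = set_val (zpoint j).
  have [r [[r' rK r'K] rE]] := strandoo (w j.+1).
  by exists (r' j); apply/S_ends; rewrite rE r'K.
have s'K : cancel s' s.
  by move=> j; apply: (@zpoint_inj R); apply: val_inj; rewrite -[LHS]sE; exact: s'E.
have sK : cancel s s'.
  by move=> i; apply: (Sinj ehloo); rewrite s'E -sE.
have [|||||l lE] := @strand_ex R S s.
- by move=> i; exact: strand_continuous.
- exact: Sinj.
- by move=> i; exact: strand0.
- by exists s'.
- exact: sE.
exists l => n; apply: close_trans (path_joined_close n (uw n)) _; split.
  apply: equiv_upto_sym; exists (w n); first exact: path_joined_refl.
  by move=> i i_n t; rewrite lE SE.
by move=> i j jn; rewrite lE S_ends; exact: ends.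
Qed.

End Completeness.

Theorem theorem24 (R : realType) : topologically_complete R (Boo_bar R).
Proof.
pose K := set_type (@paths_into R _ (@id_Zplus R) (@H_Zplus R)).
pose rp := @component_repr R K.
have rpK f : path_joined R (rp (component R f)) f.
  by apply/component_eq; exact: component_reprK.
apply: (@topologically_complete_equivalence_chain R (path_components R K)
  (fun n x y => close n (rp x) (rp y))).
- by move=> n x; apply: path_joined_close; exact: path_joined_refl.
- by move=> n x y; exact: close_sym.
- by move=> n x y z; exact: close_trans.
- by move=> n x y; exact: closeS.
- move=> x y xy; rewrite -[x]component_reprK -[y]component_reprK.
  apply/component_eq/equiv_upto_separated => n; apply: equiv_upto_sym.
  by have [] := xy n.
(* For [U] open, the preimage of [U] contains, for some [n], all braids sharing the first [n]
   strands of the representative, and every class close to [x] has such a member. Conversely, every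
   braid has a neighbourhood of braids close to it, by [near_close]. *)
- move=> U; rewrite component_open; split=> [oU x Ux|HU].
    have Ur : nbhs (rp x) (@component R K @^-1` U).
      by apply: open_nbhs_nbhs; split=> //=; rewrite component_reprK.
    have [n nU] := nbhs_agree Ur; exists n => y [[y' yy' y'x] _].
    have := nU y' y'x; rewrite /= -(_ : y = component R y')//.
    by rewrite -[y]component_reprK; apply/component_eq.
  rewrite openE => f Uf; have [n nU] := HU _ Uf.
  apply: filterS (near_close n f) => g fg; apply: nU => /=.
  apply: close_trans (path_joined_close n (rpK f)) _.
  apply: close_trans fg _; apply: path_joined_close; exact: path_joined_sym.
- move=> u uC; have [l lP] := close_complete uC; exists (component R l) => n.
  apply: close_trans (lP n) _; apply: path_joined_close; exact: path_joined_sym.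
Qed.
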